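(* Let $G$ be a graph on a linearly ordered set of edges $E$. Then $$\{\text{spanning trees of }G\}=\biguplus\Bigl\{T'_1\uplus\cdots\uplus T'_\varepsilon\uplus T_1\uplus\cdots\uplus T_\iota\ \Big|\ \text{for all }1\le k\le\varepsilon,\ T'_k\text{ is a spanning tree of }G(F'_{k-1})/F'_k\text{ with }|\mathrm{Int}(T'_k)|=0,\ |\mathrm{Ext}(T'_k)|=1;$$ $$\text{for all }1\le k\le\iota,\ T_k\text{ is a spanning tree of }G(F_k)/F_{k-1}\text{ with }|\mathrm{Int}(T_k)|=1,\ |\mathrm{Ext}(T_k)|=0\Bigr\},$$ where the disjoint union is over all connected filtrations $\emptyset=F'_\varepsilon\subset\cdots\subset F'_0=F_c=F_0\subset\cdots\subset F_\iota=E$ of $G$ (with arbitrary $\iota,\varepsilon\ge0$). With $T=T'_1\uplus\cdots\uplus T'_\varepsilon\uplus T_1\uplus\cdots\uplus T_\iota$ we then have $$\mathrm{Int}(T)=\biguplus_{1\le k\le\iota}\{\min(F_k\setminus F_{k-1})\}=\biguplus_{1\le k\le\iota}\mathrm{Int}(T_k),\qquad \mathrm{Ext}(T)=\biguplus_{1\le k\le\varepsilon}\{\min(F'_{k-1}\setminus F'_k)\}=\biguplus_{1\le k\le\varepsilon}\mathrm{Ext}(T'_k).$$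
   Context: Graphs are finite, may have loops and multiple edges, and are connected unless they arise as minors (isolated vertices are ignored, and for a disconnected graph ''spanning tree'' means maximal spanning forest). For $F\subseteq E$, $G(F)$ is the restriction of $G$ to $F$ (deletion of $E\setminus F$) and $G/F$ is the contraction of $F$. Minors inherit the linear order. Cycles and cocycles (inclusion-minimal non-empty edge cuts) are edge subsets. $\subset$ is strict inclusion, $\uplus$ disjoint union. For a spanning tree $T$ of a graph, $\mathrm{Int}(T)$ is the set of $b\in T$ such that $b$ is the smallest element of its fundamental cocycle $C^*(T;b)$ (the unique cocycle contained in $(E\setminus T)\cup\{b\}$), and $\mathrm{Ext}(T)$ is the set of $e\notin T$ such that $e$ is the smallest element of its fundamental cycle $C(T;e)$ (the unique cycle contained in $T\cup\{e\}$). For spanning trees of minors of $G$, $\mathrm{Int}$ and $\mathrm{Ext}$ are computed in the minor. A filtration of $G$ is a sequence $(F'_\varepsilon,\ldots,F'_0,F_c,F_0,\ldots,F_\iota)$ of subsets of $E$ with $\emptyset=F'_\varepsilon\subset\cdots\subset F'_0=F_c=F_0\subset\cdots\subset F_\iota=E$, such that $\min(F_k\setminus F_{k-1})$, $1\le k\le\iota$, is increasing with $k$ and $\min(F'_{k-1}\setminus F'_k)$, $1\le k\le\varepsilon$, is increasing with $k$. It is connected if for every $1\le k\le\iota$ the minor $G(F_k)/F_{k-1}$ is either loopless and 2-connected with at least two edges, or a single isthmus, and for every $1\le k\le\varepsilon$ the minor $G(F'_{k-1})/F'_k$ is either loopless and 2-connected with at least two edges, or a single loop. (2-connected means 2-vertex-connected;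 a loopless graph on two vertices with at least one edge counts as 2-connected.) *)

(* Defs.v *)
From HB Require Import structures.
From mathcomp Require Import all_boot all_order.

Set Implicit Arguments.
Unset Strict Implicit.
Unset Printing Implicit Defensive.

(* A graph whose edges are named by elements of [E].  Only the elements of
   [edges] are edges, so that all minors of a graph share the same type [E].
   The pair [ends e] is read as unordered; a loop has equal components. *)
Record graph (E : finType) := Graph {
  vertex : finType;
  edges : {set E};
  ends : E -> vertex * vertex
}.

Section Graphs.
Variable E : finType.
Implicit Types (G : graph E) (F T C : {set E}).

Definition joins G (e : E) (x y : vertex G) : bool :=
  (ends G e == (x, y)) || (ends G e == (y, x)).

Definition adj G : rel (vertex G) :=
  fun x y => [exists e in edges G, joins e x y].

(* Isolated vertices are ignored: the vertices that count are those incident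
   with an edge. *)
Definition vertices G : {set vertex G} :=
  [set x | [exists y, adj x y]].

Definition connected G : bool :=
  [forall x in vertices G, forall y in vertices G, connect (@adj G) x y].

Definition restrict G F : graph E := Graph (edges G :&: F) (ends G).

Definition component G (x : vertex G) : {set vertex G} :=
  [set y | connect (@adj G) x y].

Lemma component_in G (x : vertex G) :
  component x \in [set component z | z : vertex G].
Proof. exact: imset_f. Qed.

Definition component_type G : finType :=
  {K : {set vertex G} | K \in [set component z | z : vertex G]}.

Definition to_component G (x : vertex G) : component_type G :=
  exist _ (component x) (component_in x).

(* The vertices of G / F are the connected components of G(F). *)
Definition contract G F : graph E :=
  Graph (edges G :\: F)
        (fun e => (@to_component (restrict G F) (ends G e).1,
                   @to_component (restrict G F) (ends G e).2)).

(* The elements of [C] can be arranged as e_0, ..., e_(n-1), n = #|C| > 0, with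
   e_i joining v_i to v_(i+1 mod n) for pairwise distinct vertices v_i; this
   covers loops (n = 1) and pairs of parallel edges (n = 2). *)
Definition is_cycle G C : bool :=
  [&& C != set0, C \subset edges G &
   [exists v : {ffun 'I_#|C| -> vertex G}, exists e : {ffun 'I_#|C| -> E},
     [&& injectiveb v, [set e i | i : 'I_#|C|] == C &
      [forall i, joins (e i) (v i) (v (ordS i))]]]].

Definition edge_cut G (X : {set vertex G}) : {set E} :=
  [set e in edges G | ((ends G e).1 \in X) != ((ends G e).2 \in X)].

Definition is_cocycle G C : bool :=
  minset (fun D => (D != set0) && [exists X, D == @edge_cut G X]) C.

(* In a disconnected graph this is a spanning tree of each component, i.e. a
   maximal spanning forest. *)
Definition spanning_tree G T : bool :=
  [&& T \subset edges G,
      [forall C : {set E}, is_cycle G C ==> ~~ (C \subset T)] &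
      [forall x, forall y,
         connect (@adj G) x y ==> connect (@adj (restrict G T)) x y]].

(* For a spanning tree [T] the candidate exists and is unique; [set0] is a
   junk value outside that case. *)
Definition fund_cycle G T (e : E) : {set E} :=
  odflt set0 [pick C | is_cycle G C && (C \subset e |: T)].

Definition fund_cocycle G T (b : E) : {set E} :=
  odflt set0 [pick C | is_cocycle G C && (C \subset b |: (edges G :\: T))].

Definition is_loop G (e : E) : bool :=
  (e \in edges G) && ((ends G e).1 == (ends G e).2).

Definition loopless G : bool := [forall e, ~~ is_loop G e].

Definition is_isthmus G (e : E) : bool :=
  (e \in edges G) &&
  ~~ connect (@adj (restrict G (~: [set e]))) (ends G e).1 (ends G e).2.

Definition single_loop G : bool :=
  [exists e, (edges G == [set e]) && is_loop G e].

Definition single_isthmus G : bool :=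
  [exists e, (edges G == [set e]) && is_isthmus G e].

Definition adj_avoiding G (v : vertex G) : rel (vertex G) :=
  fun x y => [&& x != v, y != v & adj x y].

(* The set [vertices G] is taken before the deletion of [v]: a vertex that
   becomes isolated when [v] is deleted still counts.  Two vertices suffice. *)
Definition two_connected G : bool :=
  [&& 1 < #|vertices G|, connected G &
   [forall v in vertices G,
     forall x in vertices G :\ v, forall y in vertices G :\ v,
       connect (adj_avoiding v) x y]].

Definition two_connected_block G : bool :=
  [&& loopless G, two_connected G & 1 < #|edges G|].

End Graphs.

Section Activities.
Variables (d : Order.disp_t) (E : finOrderType d).
Implicit Types (G : graph E) (T A : {set E}).

(* The singleton {min A} when [A] is nonempty, and [set0] otherwise. *)
Definition least A : {set E} := [set x in A | [forall y in A, (x <= y)%O]].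

Definition int_act G T : {set E} :=
  [set b in T | b \in least (fund_cocycle G T b)].

Definition ext_act G T : {set E} :=
  [set e in edges G :\: T | e \in least (fund_cycle G T e)].

(* The data F'_eps, ..., F'_0 = F_c = F_0, ..., F_iota, stored as F_c together
   with the sequences F_1, ..., F_iota and F'_1, ..., F'_eps; the conditions
   on them are in [is_filtration]. *)
Record filtration := Filtration {
  core : {set E};
  above : seq {set E};
  below : seq {set E}
}.

Implicit Types Phi : filtration.

Definition iota_of Phi : nat := size (above Phi).
Definition eps_of Phi : nat := size (below Phi).

Definition Fup Phi (k : nat) : {set E} := nth set0 (core Phi :: above Phi) k.
Definition Fdn Phi (k : nat) : {set E} := nth set0 (core Phi :: below Phi) k.

(* From here on an index k stands for the step between positions k and k + 1 of
   a chain. *)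
Definition up_diff Phi (k : nat) : {set E} := Fup Phi k.+1 :\: Fup Phi k.
Definition dn_diff Phi (k : nat) : {set E} := Fdn Phi k :\: Fdn Phi k.+1.

Definition up_minor G Phi (k : nat) : graph E :=
  contract (restrict G (Fup Phi k.+1)) (Fup Phi k).
Definition dn_minor G Phi (k : nat) : graph E :=
  contract (restrict G (Fdn Phi k)) (Fdn Phi k.+1).

Definition min_increasing (n : nat) (D : nat -> {set E}) : Prop :=
  forall k l x y, k < l < n -> x \in least (D k) -> y \in least (D l) ->
    (x < y)%O.

Definition is_filtration G Phi : Prop :=
  [/\ Fdn Phi (eps_of Phi) = set0 /\ Fup Phi (iota_of Phi) = edges G,
      forall k, k < eps_of Phi -> Fdn Phi k.+1 \proper Fdn Phi k,
      forall k, k < iota_of Phi -> Fup Phi k \proper Fup Phi k.+1,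
      min_increasing (iota_of Phi) (up_diff Phi) &
      min_increasing (eps_of Phi) (dn_diff Phi)].

Definition connected_filtration G Phi : Prop :=
  [/\ is_filtration G Phi,
      forall k, k < iota_of Phi ->
        two_connected_block (up_minor G Phi k) ||
        single_isthmus (up_minor G Phi k) &
      forall k, k < eps_of Phi ->
        two_connected_block (dn_minor G Phi k) ||
        single_loop (dn_minor G Phi k)].

Definition tree_parts G Phi (T' : 'I_(eps_of Phi) -> {set E})
    (T_ : 'I_(iota_of Phi) -> {set E}) : Prop :=
  (forall k : 'I_(eps_of Phi),
              [/\ spanning_tree (dn_minor G Phi k) (T' k),
                 #|int_act (dn_minor G Phi k) (T' k)| = 0 &
                 #|ext_act (dn_minor G Phi k) (T' k)| = 1]) /\
  (forall k : 'I_(iota_of Phi),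
              [/\ spanning_tree (up_minor G Phi k) (T_ k),
                 #|int_act (up_minor G Phi k) (T_ k)| = 1 &
                 #|ext_act (up_minor G Phi k) (T_ k)| = 0]).

Definition all_parts (m n : nat) (T' : 'I_m -> {set E}) (T_ : 'I_n -> {set E})
    (i : 'I_m + 'I_n) : {set E} :=
  match i with inl k => T' k | inr k => T_ k end.

Definition filtration_trees G Phi (T : {set E}) : Prop :=
  exists (T' : 'I_(eps_of Phi) -> {set E}) (T_ : 'I_(iota_of Phi) -> {set E}),
    tree_parts G T' T_ /\ T = \bigcup_i all_parts T' T_ i.

Definition disjoint_union (I : finType) (A : I -> {set E}) (B : {set E}) : Prop :=
  B = \bigcup_i A i /\ (forall i j, i != j -> [disjoint A i & A j]).

End Activities.

(* Main.v *)
Require Import Defs.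
From mathcomp Require Import all_boot all_order.

Set Implicit Arguments.
Unset Strict Implicit.
Unset Printing Implicit Defensive.

Import Order.TTheory.

(** The filtration attached to a spanning tree [T] can be read on the bipartite
    fundamental graph of [T], in which [b] in [T] and an edge [e] outside [T]
    are linked when exchanging them gives another spanning tree.  An element is
    active, internally if it lies in [T] and externally otherwise, when it is
    smaller than all its neighbours.

    A set [F] of edges splits [T] into a spanning tree of the restriction to [F]
    and one of the contraction of [F] exactly when every neighbour of an element
    of [F] outside [T] is again in [F] ([spans_inP]).  For two such sets
    [F'] and [F], with [F'] contained in [F], the fundamental graph of the part
    of [T] in the minor on [F :\: F'] is the induced one ([linked_minor]).  So
    the theorem becomes a statement on a bipartite graph with ordered vertices
    ([adapted]).

    In a block with a single active element, that element is the minimum of the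
    block, and each other element has a smaller neighbour in the same block.
    Together with the closure property this forces a rule: a nonactive element
    of [T] is in a member [F] of the filtration if and only if some smaller
    neighbour is, and a nonactive element outside [T] is in [F] if and only if
    all its smaller neighbours are.  By induction along the order, [F] is
    determined by its active elements; as the minima of the blocks increase,
    these are the externally active elements and an initial segment of the
    internally active ones, or a final segment of the externally active ones.
    This gives uniqueness ([adapted_unique]).  Conversely, the rule
    generates a set from any set of active elements, and adding one active
    element to the latter adds a block of the required kind to the former
    ([generated_block]), which gives existence ([adapted_filtration_of]).

    The blocks so obtained are connected for free: if a graph splits into two
    parts without links between them, the minima of both parts are active, so a
    spanning tree with one active element forces a 2-connected graph or a
    single edge ([block_of_activity]).  In the other direction, spanning trees of the
    minors of a filtration glue to a spanning tree of the graph
    ([tree_in_glue]). *)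

(** * Connection and span *)

Section Connection.
Variables (E : finType) (H : graph E).
Implicit Types (S T C : {set E}) (x y z : vertex H).

Definition conn S : rel (vertex H) := connect (@adj E (restrict H S)).

(** The closure operator of the cycle matroid: it lets spanning trees,
    fundamental cycles and fundamental cocycles be handled without looking at
    paths again. *)
Definition span S : {set E} :=
  [set e in edges H | conn S (ends H e).1 (ends H e).2].

Lemma joins_endsP (e : E) x y :
  reflect ((ends H e).1 = x /\ (ends H e).2 = y \/
           (ends H e).1 = y /\ (ends H e).2 = x) (joins e x y).
Proof.
rewrite /joins; case: (ends H e) => a b /=.
by apply: (iffP orP) => -[]; [move/eqP=> []|move/eqP=> []|case|case] => -> ->; auto.
Qed.

Lemma joinsC (e : E) x y : joins e x y = joins e y x.
Proof. by rewrite /joins orbC. Qed.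

Lemma restrict_adjP S x y :
  reflect (exists2 e, e \in edges H :&: S & joins e x y)
          (@adj E (restrict H S) x y).
Proof. exact: exists_inP. Qed.

Lemma conn0 S x : conn S x x. Proof. exact: connect0. Qed.

Lemma connC S x y : conn S x y = conn S y x.
Proof.
apply: sym_connect_sym => u v.
by apply/restrict_adjP/restrict_adjP => -[e eS]; rewrite joinsC; exists e.
Qed.

Lemma conn_trans S : transitive (conn S). Proof. exact: connect_trans. Qed.

Lemma conn_joins S (e : E) x y :
  e \in edges H -> e \in S -> joins e x y -> conn S x y.
Proof.
by move=> eH eS j; apply/connect1/restrict_adjP; exists e; rewrite ?inE ?eH.
Qed.

Lemma conn_ends S (e : E) :
  e \in edges H -> e \in S -> conn S (ends H e).1 (ends H e).2.
Proof. by move=> eH eS; apply: (conn_joins eH eS); apply/joins_endsP; left. Qed.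

(** Connection is the least equivalence relation containing the pairs of ends;
    every later inclusion of connection relations comes from this. *)
Lemma conn_min S (r : vertex H -> vertex H -> Prop) :
  (forall x, r x x) -> (forall x y, r x y -> r y x) ->
  (forall x y z, r x y -> r y z -> r x z) ->
  (forall e, e \in edges H -> e \in S -> r (ends H e).1 (ends H e).2) ->
  forall x y, conn S x y -> r x y.
Proof.
move=> r0 rC rT rE x y /connectP[p + ->].
elim: p x => [|z p IHp] x //= /andP[/restrict_adjP[e]].
rewrite inE => /andP[eH eS] /joins_endsP j /IHp; apply: rT.
by case: j => [] [<- <-]; [|apply: rC]; apply: rE.
Qed.

Lemma conn_span S S' :
  edges H :&: S \subset span S' -> forall x y, conn S x y -> conn S' x y.
Proof.
move=> sSS'; apply: conn_min => [x|x y|x y z|e eH eS].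
- exact: conn0.
- by rewrite connC.
- exact: conn_trans.
- have: e \in span S' by apply: (subsetP sSS'); rewrite inE eH.
  by rewrite inE => /andP[].
Qed.

Lemma conn_project (p : vertex H -> vertex H) S S' x y :
  (forall e, e \in edges H -> e \in S -> conn S' (p (ends H e).1) (p (ends H e).2)) ->
  conn S x y -> conn S' (p x) (p y).
Proof.
move=> pE; move: x y; apply: conn_min => // [x|x y|x y z].
- exact: conn0.
- by rewrite connC.
- exact: conn_trans.
Qed.

Lemma sub_span S : edges H :&: S \subset span S.
Proof.
by apply/subsetP => e; rewrite !inE => /andP[eH eS]; rewrite eH conn_ends.
Qed.

Lemma mem_span S e : e \in edges H -> e \in S -> e \in span S.
Proof. by move=> eH eS; apply: (subsetP (sub_span S)); rewrite inE eH. Qed.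

Lemma span_sub S S' : edges H :&: S \subset span S' -> span S \subset span S'.
Proof.
move=> sSS'; apply/subsetP => e; rewrite !inE => /andP[-> /=].
exact: conn_span.
Qed.

Lemma spanS S S' : S \subset S' -> span S \subset span S'.
Proof.
by move=> sSS'; apply: span_sub; apply: subset_trans (sub_span _); apply: setIS.
Qed.

Lemma conn_add S (f : E) x y : conn (f |: S) x y -> conn S x y \/
  (forall z, z = x \/ z = y ->
     conn S z (ends H f).1 || conn S z (ends H f).2).
Proof.
set Z := fun z => conn S z (ends H f).1 || conn S z (ends H f).2.
have ZT z z' : conn S z z' -> Z z' -> Z z.
  by move=> zz' /orP[] h; apply/orP; [left|right]; apply: conn_trans h.
suff h : conn (f |: S) x y -> conn S x y \/ Z x /\ Z y.
  by move=> /h[|[Zx Zy]]; [left|right=> z [] ->].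
apply: (@conn_min _ (fun x y => conn S x y \/ Z x /\ Z y)) => {x y}.
- by move=> x; left; apply: conn0.
- by move=> x y; rewrite connC => -[|[]]; auto.
- move=> x y z [xy|[Zx Zy]] [yz|[Zy' Zz]]; auto.
  + by left; apply: conn_trans yz.
  + by right; split=> //; apply: ZT xy _.
  + by right; split=> //; apply: ZT Zy; rewrite connC.
- move=> e eH; rewrite in_setU1 => /predU1P[->|eS].
    by right; rewrite /Z !conn0 orbT.
  by left; apply: conn_ends.
Qed.

Lemma span_exchange S e f : f \in edges H ->
  e \in span (f |: S) -> e \notin span S -> f \in span (e |: S).
Proof.
move=> fH; rewrite !inE => /andP[eH]; rewrite eH fH /=.
set a := (ends H e).1; set b := (ends H e).2.
have h x y : conn S x y -> conn (e |: S) x y.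
  by apply: conn_span; apply: subset_trans (sub_span _); rewrite setIS // subsetU1.
have ab : conn (e |: S) a b by apply: conn_ends; rewrite ?setU11.
move=> /conn_add[->//|Z nab].
have [Za Zb] := (Z a (or_introl erefl), Z b (or_intror erefl)).
move: Za Zb; rewrite ![conn S a _]connC ![conn S b _]connC.
case/orP=> [a1|a2] /orP[b1|b2].
- by case/negP: nab; apply: conn_trans b1; rewrite connC.
- by apply: conn_trans (conn_trans (h _ _ a1) ab) _; rewrite connC h.
- by rewrite connC; apply: conn_trans (conn_trans (h _ _ a2) ab) _; rewrite connC h.
- by case/negP: nab; apply: conn_trans b2; rewrite connC.
Qed.

(** ** Cycles *)

Lemma iter_ordS n (i : 'I_n) k : iter k (@ordS n) i = (i + k) %% n :> nat.
Proof.
elim: k => [|k IHk] /=; first by rewrite addn0 modn_small.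
by rewrite IHk -addn1 modnDml addn1 addnS.
Qed.

(** Going around a cycle from one end of an edge to the other avoids that
    edge. *)
Lemma cycle_span C f : is_cycle H C -> f \in C -> f \in span (C :\ f).
Proof.
case/and3P=> _ /subsetP sCH /existsP[v /existsP[e /and3P[_ /eqP defC /forallP ej]]] fC.
have einj : injective e.
  have: #|[set e i | i : 'I_#|C|]| == #|'I_#|C| | by rewrite defC card_ord.
  by move/imset_injP => h x y; apply: h.
have: f \in [set e i | i : 'I_#|C|] by rewrite defC.
case/imsetP=> i _ def_f.
have /subsetP sC : [set e i | i : 'I_#|C|] \subset C by rewrite defC.
have inC j : e j \in C by apply: sC; apply: imset_f.
have path k : k < #|C| -> conn (C :\ f) (v (ordS i)) (v (iter k.+1 (@ordS _) i)).
  (* The edge used at this step is not [f]: coming back to position [i] takes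
     a multiple of [#|C|] steps. *)
  elim: k => [|k IHk] ltk; first exact: conn0.
  apply: conn_trans (IHk (ltnW ltk)) _.
  apply: (@conn_joins _ (e (iter k.+1 (@ordS _) i))); rewrite ?sCH ?inC //.
    rewrite in_setD1 inC andbT def_f (inj_eq einj); apply/eqP.
    move/(congr1 (@nat_of_ord _)); rewrite iter_ordS => h.
    have := divn_eq (i + k.+1) #|C|; rewrite h addnC => /addIn h'.
    have: #|C| %| k.+1 by rewrite h' dvdn_mull.
    by move/dvdn_leq => /(_ isT); rewrite leqNgt ltk.
have C0 : 0 < #|C| by apply/card_gt0P; exists f.
have := path #|C|.-1; rewrite prednK // leqnn => /(_ isT).
have -> : iter #|C| (@ordS _) i = i.
  by apply: val_inj; rewrite /= iter_ordS modnDr modn_small.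
move=> c; rewrite inE sCH //= def_f; rewrite def_f in c.
have /joins_endsP := ej i; case=> [] [-> ->] //.
by rewrite connC.
Qed.

(** Here the length [n] is free, which spares the users of this lemma the
    dependence of index types on the cardinal of [C]. *)
Lemma is_cycle_intro n (v : 'I_n -> vertex H) (e : 'I_n -> E) C :
  0 < n -> injective v -> injective e -> [set e i | i : 'I_n] = C ->
  C \subset edges H -> (forall i, joins (e i) (v i) (v (ordS i))) ->
  is_cycle H C.
Proof.
move=> n0 vi ei defC sC ej.
have def_n : n = #|C| by rewrite -defC card_imset // card_ord.
subst n; apply/and3P; split=> //; first by rewrite -card_gt0.
apply/existsP; exists (finfun v); apply/existsP; exists (finfun e).
apply/and3P; split.
- by apply/injectiveP => i j; rewrite !ffunE => /vi.
- apply/eqP; apply: etrans defC; apply: eq_imset => i; exact: ffunE.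
- by apply/forallP => i; rewrite !ffunE.
Qed.

(** A shortest path between the ends of an edge, closed by this edge. *)
Lemma span_cycle S f : f \in edges H -> f \notin S -> f \in span S ->
  exists C, [/\ is_cycle H C, f \in C & C \subset f |: S].
Proof.
move=> fH fS; rewrite inE fH => /connectP[p0 pp0 lp0].
case/shortenP: pp0 lp0 => p pp up _ lp.
set x := (ends H f).1 in pp up lp; set n := size p.
pose vs i := nth x (x :: p) i.
have step i : i < n -> exists2 e, e \in edges H :&: S & joins e (vs i) (vs i.+1).
  by move=> ltin; apply/restrict_adjP; have /pathP := pp; apply.
pose ed i := odflt f [pick e | (e \in edges H :&: S) && joins e (vs i) (vs i.+1)].
have edP i : i < n -> ed i \in edges H :&: S /\ joins (ed i) (vs i) (vs i.+1).
  move=> /step[e e1 e2]; rewrite /ed; case: pickP => [e' /andP[]//|/(_ e)].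
  by rewrite e1 e2.
pose e (i : 'I_n.+1) := if i < n then ed i else f.
pose v (i : 'I_n.+1) := vs i.
have eS (i : 'I_n.+1) : i < n -> e i \in S /\ e i \in edges H.
  by rewrite /e => h; rewrite h; have [] := edP _ h; rewrite inE => /andP[].
have vi : injective v.
  by move=> i j /eqP; rewrite /v /vs nth_uniq //= => /eqP/val_inj.
have vsi i j : vs i = vs j -> i <= n -> j <= n -> i = j.
  by move=> /eqP vij hi hj; move: vij; rewrite /vs nth_uniq // => /eqP.
(* Two steps of a path without repeated vertices have different pairs of ends,
   and [f] is not used by the path as it is not in [S]. *)
have ei : injective e.
  move=> i j; have := ltn_ord i; have := ltn_ord j; rewrite !ltnS => lej lei.
  case: (ltnP i n) => hi; case: (ltnP j n) => hj.
  - rewrite /e hi hj => eij; apply: val_inj => /=.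
    have [_ /joins_endsP ji] := edP _ hi; have [_ /joins_endsP jj] := edP _ hj.
    move: ji jj; rewrite eij.
    case=> [] [-> ->] [] [h1 h2]; move: (vsi _ _ h1) (vsi _ _ h2) => {}h1 {}h2.
    + by apply: h1.
    + move: (h1 lei hj) (h2 hi lej) => -> /esym/eqP.
      by rewrite eqn_leq ltnNge leqnSn andbF.
    + move: (h1 hi lej) (h2 lei hj) => <- /eqP.
      by rewrite eqn_leq ltnNge leqnSn andbF.
    + by apply: h2.
  - by move=> eij; have [] := eS _ hi; rewrite eij /e ltnNge hj /= (negPf fS).
  - by move=> eij; have [] := eS _ hj; rewrite -eij /e ltnNge hi /= (negPf fS).
  - move=> _; apply: val_inj => /=.
    by apply/eqP; rewrite eqn_leq (leq_trans lei hj) (leq_trans lej hi).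
exists [set e i | i : 'I_n.+1]; split.
- apply: (@is_cycle_intro n.+1 v e) => //.
    apply/subsetP => _ /imsetP[i _ ->]; case: (ltnP i n) => [/eS[]//|h].
    by rewrite /e ltnNge h.
  move=> i; rewrite /e /v; case: (ltnP i n) => [h|h].
    by have [_] := edP _ h; rewrite /= modn_small.
  have -> : i = ord_max by apply: val_inj; apply/eqP; rewrite eqn_leq h -ltnS ltn_ord.
  rewrite /= modnn; apply/joins_endsP; right; split=> //.
  by rewrite lp /vs (last_nth x).
- by apply/imsetP; exists ord_max; rewrite // /e ltnn.
- apply/subsetP => _ /imsetP[i _ ->]; rewrite in_setU1.
  by case: (ltnP i n) => [/eS[->]|h]; rewrite ?orbT // /e ltnNge h eqxx.
Qed.

End Connection.

(** * Spanning trees as bases *)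

Section Trees.
Variables (E : finType) (H : graph E).
Implicit Types (S T C D F : {set E}) (e f b : E).

Definition indep T : Prop := forall f, f \in T -> f \notin span H (T :\ f).

Lemma indepP T : T \subset edges H ->
  indep T <-> forall C, is_cycle H C -> ~~ (C \subset T).
Proof.
move=> sTH; split=> [iT C cC|acT f fT].
  apply/negP => sCT; have /and3P[/set0Pn[f fC] _ _] := cC.
  case/negP: (iT f (subsetP sCT _ fC)).
  exact: (subsetP (spanS H (setSD _ sCT))) (cycle_span cC fC).
apply/negP => /(span_cycle (subsetP sTH _ fT)); rewrite !inE eqxx => /(_ isT).
by case=> C [/acT cC _]; rewrite setD1K // (negPf cC).
Qed.

Lemma spanning_treeP T :
  spanning_tree H T <->
  [/\ T \subset edges H, indep T & edges H \subset span H T].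
Proof.
have adjE : connect (@adj E H) =2 conn (edges H).
  apply: eq_connect => x y; apply/idP/idP => [|/restrict_adjP[e]].
    by case/exists_inP=> e eH j; apply/restrict_adjP; exists e; rewrite ?setIid.
  by rewrite setIid => eH j; apply/exists_inP; exists e.
have spP : edges H \subset span H T <->
    [forall x, forall y, connect (@adj E H) x y ==> connect (@adj E (restrict H T)) x y].
  split=> [sp|/forallP sp].
    apply/forallP => x; apply/forallP => y; apply/implyP; rewrite adjE.
    by apply: conn_span; rewrite setIid.
  apply/subsetP => e eH; rewrite inE eH /=.
  have /forallP/(_ (ends H e).2)/implyP := sp (ends H e).1; apply.
  by rewrite adjE conn_ends.
split=> [/and3P[sT /forall_inP acT /spP sp]|[sT iT /spP sp]].
  by split=> //; apply/indepP.
apply/and3P; split=> //; apply/forall_inP => C; exact: (indepP sT).1.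
Qed.

(** Within an independent set, an element that can be avoided separately from
    [S] can be avoided inside [S], since otherwise exchange would put [b] in
    the span of the other elements. *)
Lemma span_delete T S b e : T \subset edges H -> indep T -> S \subset T ->
  e \in span H S -> e \in span H (T :\ b) -> e \in span H (S :\ b).
Proof.
move=> sT iT sST eS eb; case: (boolP (b \in S)) => bS; last first.
  by rewrite (setDidPl _) // disjoint_sym disjoints1.
have bT := subsetP sST _ bS; apply/negPn/negP => neS; case/negP: (iT _ bT).
have : b \in span H (e |: (S :\ b)).
  by apply: span_exchange neS; rewrite ?(subsetP sT) // setD1K.
apply/subsetP/span_sub/subsetP => f; rewrite inE => /andP[fH].
case/setU1P=> [->//|fS]; apply: mem_span => //.
exact: subsetP (setSD _ sST) _ fS.
Qed.

(** A subset of [T] containing [S] and minimal among those spanning [e] is [S]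
    itself, since any further element could be removed. *)
Lemma span_avoid T S e : T \subset edges H -> indep T -> S \subset T ->
  e \in span H T -> (forall b, b \in T -> b \notin S -> e \in span H (T :\ b)) ->
  e \in span H S.
Proof.
move=> sT iT sST eT avoid.
pose P (U : {set E}) := [&& S \subset U, U \subset T & e \in span H U].
have PT : P T by apply/and3P.
have [U /minsetP[/and3P[sSU sUT eU] minU] _] := minset_exists PT.
case: (altP (U =P S)) => [<-//|nUS].
have /properP[_ [b bU bS]] : S \proper U by rewrite properEneq eq_sym nUS.
have bT := subsetP sUT _ bU.
have PUb : P (U :\ b).
  apply/and3P; split; first by rewrite subsetD1 sSU.
    exact: subset_trans (subsetDl _ _) sUT.
  exact: span_delete sT iT sUT eU (avoid _ bT bS).
by have /setP/(_ b) := minU _ PUb (subsetDl _ _); rewrite !inE eqxx bU.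
Qed.

(** The edges of the fundamental graph of [T]: an element of [T] and an edge
    outside [T] are linked when the former is on the fundamental cycle of the
    latter, or equivalently the latter in the fundamental cocycle of the
    former.  The relation is symmetrized so that both kinds of activity have the
    same description. *)
Definition linked T : rel E := fun x y =>
  [&& x \in T, y \in edges H :\: T & y \notin span H (T :\ x)] ||
  [&& y \in T, x \in edges H :\: T & x \notin span H (T :\ y)].

Lemma linkedC T x y : linked T x y = linked T y x.
Proof. exact: orbC. Qed.

Lemma linked_side T x y : linked T x y -> (x \in T) != (y \in T).
Proof.
by case/orP=> /and3P[-> /setDP[_ /negPf->]].
Qed.

Lemma linked_in T b e : b \in T ->
  linked T b e = (e \in edges H :\: T) && (e \notin span H (T :\ b)).
Proof.
by move=> bT; rewrite /linked bT !inE bT /= !andbF orbF.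
Qed.

Lemma linked_out T b e : e \in edges H :\: T ->
  linked T e b = (b \in T) && (e \notin span H (T :\ b)).
Proof.
move=> eHT; rewrite linkedC; case: (boolP (b \in T)) => bT.
  by rewrite linked_in // eHT.
case: (boolP (linked T b e)) => // /linked_side.
by rewrite (negPf bT); case/setDP: eHT => _ /negPf->.
Qed.

(** If a cycle [C] in [e |: T] contains [f] in [T], the edges of [C] other than
    [f] span [f], so [e] cannot be in the span of [T] minus [f], which would then
    contain [f]; if it does not, its edges other than [e] span [e] without
    [f]. *)
Lemma fund_cycleE T e : spanning_tree H T -> e \in edges H :\: T ->
  fund_cycle H T e = e |: [set f | linked T e f].
Proof.
move=> /spanning_treeP[sT iT sp] eHT.
have [eH eT] := setDP eHT.
have fE C : is_cycle H C -> C \subset e |: T -> C = e |: [set f | linked T e f].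
  move=> cC sC; have eC : e \in C.
    apply/negPn/negP => eC; case/negP: ((indepP sT).1 iT C cC).
    apply/subsetP => f fC; have /setU1P[def_f|//] := subsetP sC _ fC.
    by rewrite -def_f fC in eC.
  apply/setP => f; rewrite in_setU1 inE linked_out //.
  case: (eqVneq f e) => [->|nfe] /=; first by [].
  apply/idP/andP => [fC|[fT]].
    have /setU1P[/eqP|fT] := subsetP sC _ fC; first by rewrite (negPf nfe).
    split=> //; apply: contra (iT f fT) => espf.
    have := cycle_span cC fC; apply/subsetP/span_sub/subsetP => g.
    rewrite inE => /andP[gH] /setD1P[ngf gC].
    have /setU1P[->//|gT] := subsetP sC _ gC.
    by apply: mem_span; rewrite // !inE ngf.
  apply: contraR => fC; apply: subsetP (cycle_span cC eC).
  apply: spanS; apply/subsetP => g /setD1P[nge gC]; rewrite !inE.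
  have /setU1P[/eqP|->] := subsetP sC _ gC; first by rewrite (negPf nge).
  by rewrite andbT; apply: contraNneq fC => <-.
rewrite /fund_cycle; case: pickP => [C /andP[cC sC]|none] /=; first exact: fE.
have [C [cC _ sC]] := span_cycle eH eT (subsetP sp _ eH).
by have := none C; rewrite cC sC.
Qed.

Lemma conn_cut (X : {set vertex H}) S x y :
  {in S, forall e, e \notin edge_cut X} -> conn S x y -> (x \in X) = (y \in X).
Proof.
move=> dis; move: x y; apply: conn_min => [//|//|x y z ->//|e eH eS].
by apply/eqP; have := dis _ eS; rewrite !inE eH negbK.
Qed.

Lemma span_cut (X : {set vertex H}) S e :
  {in S, forall f, f \notin edge_cut X} -> e \in edge_cut X -> e \notin span H S.
Proof.
move=> dis; rewrite !inE => /andP[-> /=]; apply: contra => c.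
by rewrite (conn_cut dis c).
Qed.

(** The fundamental cocycle of [b] is the cut around a component of [T] minus
    [b]; every nonempty cut that meets [T] in [b] only is equal to it. *)
Lemma fund_cocycleE T b : spanning_tree H T -> b \in T ->
  fund_cocycle H T b = b |: [set e | linked T b e].
Proof.
move=> /spanning_treeP[sT iT sp] bT.
have bH := subsetP sT _ bT.
set D0 := _ |: _.
have inD0 e : (e \in D0) = (e \in edges H) && (e \notin span H (T :\ b)).
  rewrite in_setU1 inE linked_in //; case: (eqVneq e b) => [->|neb] /=.
    by rewrite bH iT.
  rewrite inE; case: (boolP (e \in T)) => //= eT.
  rewrite mem_span ?andbF //; first exact: subsetP eT.
  by rewrite !inE neb.
have cutD0 (X : {set vertex H}) : edge_cut X != set0 ->
    edge_cut X \subset b |: (edges H :\: T) -> edge_cut X = D0.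
  move=> /set0Pn[e0 e0X] sD.
  have disb : {in T :\ b, forall f, f \notin edge_cut X}.
    move=> f /setD1P[nfb fT]; apply: contra nfb => /(subsetP sD).
    by rewrite !inE fT orbF.
  have bX : b \in edge_cut X.
    apply/negPn/negP => bX; suff/negP : e0 \notin span H T.
      by apply; apply: (subsetP sp); move: e0X; rewrite inE => /andP[].
    apply: span_cut e0X => f fT; case: (eqVneq f b) => [->//|nfb].
    by apply: disb; rewrite !inE nfb.
  apply/setP => e; rewrite inD0; apply/idP/andP => [eX|[eH neb]].
    by split; [move: eX; rewrite inE => /andP[] | exact: span_cut eX].
  apply/negPn/negP => eX.
  suff/negP : b \notin span H (e |: (T :\ b)).
    by apply; apply: span_exchange neb => //; rewrite setD1K // (subsetP sp).
  by apply: span_cut bX => f /setU1P[->|/disb].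
pose X0 := [set z | conn (T :\ b) (ends H b).1 z].
have X0E : edge_cut X0 = D0.
  apply/setP => e; rewrite inD0 [LHS]inE; case: (boolP (e \in edges H)) => eH //=.
  rewrite !inE eH /=; apply/idP/idP => [|nc].
    apply: contraNN => c; apply/eqP; apply/idP/idP => h.
      exact: conn_trans c.
    by apply: conn_trans h _; rewrite connC.
  apply/negP => /eqP cE; case/negP: nc.
  case: (boolP (conn (T :\ b) (ends H b).1 (ends H e).1)) cE => c1 /esym c2.
    by apply: conn_trans c2; rewrite connC.
  have : e \in span H (b |: (T :\ b)) by rewrite setD1K // (subsetP sp).
  rewrite inE eH => /conn_add[//|Z].
  have := Z _ (or_introl erefl); rewrite connC (negPf c1) /= => Z1.
  have := Z _ (or_intror erefl); rewrite connC c2 /= connC => Z2.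
  exact: conn_trans Z1 Z2.
have D00 : D0 != set0 by apply/set0Pn; exists b; rewrite setU11.
have sD0 : D0 \subset b |: (edges H :\: T).
  by apply: setUS; apply/subsetP => e; rewrite inE linked_in // => /andP[].
rewrite /fund_cocycle; case: pickP => [C /andP[cC sC]|none] /=.
  case/minsetP: cC sC => /andP[C0 /existsP[X /eqP defC]] _ sC.
  by rewrite defC; apply: cutD0; rewrite -defC.
suff: is_cocycle H D0 && (D0 \subset b |: (edges H :\: T)) by rewrite none.
rewrite sD0 andbT; apply/minsetP; split.
  by rewrite D00; apply/existsP; exists X0; rewrite X0E.
move=> D /andP[D_0 /existsP[X /eqP defD]] sD; rewrite defD; apply: cutD0.
  by rewrite -defD.
by rewrite -defD; apply: subset_trans sD0.
Qed.

End Trees.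

(** * Minors *)

Section Minors.
Variables (E : finType) (G : graph E).
Implicit Types (S T C D F : {set E}) (e f b : E).

Definition minor F' F : graph E := contract (restrict G F) F'.

Lemma conn_restrict F S : conn (H := restrict G F) S =2 conn (H := G) (F :&: S).
Proof. by apply: eq_connect => x y; rewrite /adj /= setIA. Qed.

Definition minor_vertex F' F (x : vertex G) : vertex (minor F' F) :=
  @to_component E (restrict (restrict G F) F') x.

Lemma minor_vertex_eq F' F (x y : vertex G) :
  minor_vertex F' F x = minor_vertex F' F y <-> conn (H := G) (F :&: F') x y.
Proof.
rewrite -conn_restrict; split=> [/(congr1 val)/setP/(_ y)|c].
  by rewrite !inE => h; apply: etrans h _; exact: connect0.
apply: val_inj; apply/setP => z; rewrite !inE.
apply/idP/idP; apply: conn_trans => //.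
by move: c; rewrite connC.
Qed.

Lemma minor_vertex_surj F' F (k : vertex (minor F' F)) :
  exists x, k = minor_vertex F' F x.
Proof.
by case: k => k kP; have /imsetP[x _ def_k] := kP; exists x; apply: val_inj.
Qed.

Variables (F' F : {set E}).
Hypotheses (sF'F : F' \subset F) (sFG : F \subset edges G).

Lemma edges_minor : edges (minor F' F) = F :\: F'.
Proof. by rewrite /= (setIidPr sFG). Qed.

(** Paths of the minor lift to [G] because the set of vertices contracted to
    one is connected by [F']. *)
Lemma minor_conn S (x y : vertex G) : S \subset F ->
  conn (H := minor F' F) S (minor_vertex F' F x) (minor_vertex F' F y)
  = conn (H := G) (F' :|: S) x y.
Proof.
move=> sSF.
have to_conn u v : minor_vertex F' F u = minor_vertex F' F v ->
    conn (H := G) (F' :|: S) u v.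
  move/minor_vertex_eq; apply: conn_span; apply: subset_trans (sub_span _ _).
  by apply/setIS/subsetU; rewrite subsetIr.
apply/idP/idP.
  pose r (k l : vertex (minor F' F)) := forall x y, k = minor_vertex F' F x ->
    l = minor_vertex F' F y -> conn (H := G) (F' :|: S) x y.
  suff h k l : conn (H := minor F' F) S k l -> r k l by move/h; apply.
  apply: conn_min => {k l} [k|k l|k l m|e]; rewrite /r.
  - by move=> u v -> /to_conn.
  - by move=> h u v ku lv; rewrite connC; apply: h.
  - have [w def_l] := minor_vertex_surj l => h1 h2 u v ku mv.
    exact: conn_trans (h1 u w ku def_l) (h2 w v def_l mv).
  - rewrite edges_minor => /setDP[eF _] eS u v /to_conn c1 /to_conn c2.
    apply: (@conn_trans _ _ _ (ends G e).1); first by rewrite connC.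
    apply: conn_trans c2; apply: conn_ends; first exact: subsetP eF.
    by rewrite inE eS orbT.
apply: (@conn_min _ _ _ (fun x y => is_true (conn (H := minor F' F) S
    (minor_vertex F' F x) (minor_vertex F' F y)))) => {x y} [x|x y|x y z|e eG].
- exact: conn0.
- by rewrite connC.
- exact: conn_trans.
case: (boolP (e \in F')) => [eF' _|eF' /setUP[/(negP eF')//|eS]].
  have -> : minor_vertex F' F (ends G e).1
      = minor_vertex F' F (ends G e).2.
    by apply/minor_vertex_eq/conn_ends; rewrite // inE (subsetP sF'F).
  exact: conn0.
apply: (@conn_ends _ (minor F' F) S e) => //.
by rewrite edges_minor inE eF' (subsetP sSF).
Qed.

Lemma span_minor S : S \subset F ->
  span (minor F' F) S = (span G (F' :|: S) :&: F) :\: F'.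
Proof.
move=> sSF; apply/setP => e; rewrite inE edges_minor !inE.
case: (boolP (e \in F)) => eF; rewrite ?andbF //= !andbT.
by rewrite (subsetP sFG) // minor_conn.
Qed.

Lemma in_span_minor S e : S \subset F -> e \in F :\: F' ->
  (e \in span (minor F' F) S) = (e \in span G (F' :|: S)).
Proof.
by move=> sSF /setDP[eF eF']; rewrite span_minor // !inE eF eF' andbT.
Qed.

End Minors.

Section TreesOfMinors.
Variables (E : finType) (G : graph E).
Implicit Types (S T C D F : {set E}) (e f b : E).

(** For a spanning tree [T] of [G], this says that [T :&: F] is a spanning tree
    of the restriction of [G] to [F]. *)
Definition spans_in T F := F \subset span G (T :&: F).

(** If [F] contains the neighbours of its elements outside [T], the span of
    each of these can avoid all elements of [T] outside [F]. *)
Lemma spans_inP T F : spanning_tree G T -> F \subset edges G ->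
  spans_in T F <-> (forall x y, linked G T x y -> x \in F -> x \notin T -> y \in F).
Proof.
move=> tT sFG; have /spanning_treeP[sT iT sp] := tT; split=> [sF x y lxy xF xT|cF].
  have xGT : x \in edges G :\: T by rewrite inE xT (subsetP sFG).
  move: lxy; rewrite linked_out // => /andP[yT]; apply: contraR => yF.
  apply: subsetP (subsetP sF _ xF); apply/spanS/subsetP => z.
  by rewrite !inE => /andP[-> zF]; rewrite andbT; apply: contraNneq yF => <-.
apply/subsetP => e eF; have eG := subsetP sFG _ eF.
case: (boolP (e \in T)) => eT; first by apply: mem_span; rewrite // inE eT.
apply: (span_avoid sT iT (subsetIl _ _)); first exact: (subsetP sp).
move=> b bT; rewrite in_setI bT /=; apply: contraR => eb.
by apply: (cF e b) => //; rewrite linked_out ?bT // in_setD eT.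
Qed.

Variables (T F' F : {set E}).
Hypotheses (tT : spanning_tree G T) (sF'F : F' \subset F).
Hypotheses (sFG : F \subset edges G) (spF' : spans_in T F') (spF : spans_in T F).

Lemma span_block S : F' :&: T \subset S -> span G (F' :|: S) = span G S.
Proof.
move=> sS; apply/eqP; rewrite eqEsubset; apply/andP; split; last exact/spanS/subsetUr.
apply/span_sub/subsetP => e /setIP[eG /setUP[eF'|eS]].
  apply: subsetP (subsetP spF' _ eF'); apply: spanS.
  by rewrite setIC.
exact: mem_span.
Qed.

Lemma span_block_delete b : b \in T :&: (F :\: F') ->
  span G (F' :|: (T :&: (F :\: F')) :\ b) = span G ((T :&: F) :\ b).
Proof.
case/setIP=> bT /setDP[bF bF']; rewrite -(@span_block ((T :&: F) :\ b)).
  congr (span G _); apply/setP => e; rewrite !inE.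
  by case: (boolP (e \in F')) => //= _; rewrite andbCA andbA.
apply/subsetP => e /setIP[eF' eT]; rewrite !inE eT (subsetP sF'F) // !andbT.
by apply: contraNneq bF' => <-.
Qed.

Lemma tree_of_minor : spanning_tree (minor G F' F) (T :&: (F :\: F')).
Proof.
have /spanning_treeP[sT iT sp] := tT; apply/spanning_treeP; split.
- by rewrite edges_minor // subsetIr.
- move=> f fA; have /setIP[fT fF] := fA.
  rewrite in_span_minor //; last first.
    by apply/subsetP => e; rewrite !inE => /and3P[_ _ /andP[]].
  rewrite span_block_delete //; apply: contra (iT f fT).
  exact/subsetP/spanS/setSD/subsetIl.
- apply/subsetP => e; rewrite edges_minor // => eA; have /setDP[eF eF'] := eA.
  rewrite in_span_minor //; last by apply/subsetP => f; rewrite !inE => /and3P[].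
  apply: subsetP (subsetP spF _ eF); apply: spanS; apply/subsetP => f.
  by rewrite !inE => /andP[-> ->]; rewrite andbT orbN.
Qed.

(** The fundamental graph of the part of [T] in a minor is induced by that of
    [T]; this is what makes activities of minors comparable with those of
    [G]. *)
Lemma linked_minor : {in F :\: F' &,
  linked (minor G F' F) (T :&: (F :\: F')) =2 linked G T}.
Proof.
have /spanning_treeP[sT iT sp] := tT.
suff h b e : b \in F :\: F' -> e \in F :\: F' ->
    [&& b \in T :&: (F :\: F'), e \in edges (minor G F' F) :\: (T :&: (F :\: F'))
      & e \notin span (minor G F' F) (T :&: (F :\: F') :\ b)]
    = [&& b \in T, e \in edges G :\: T & e \notin span G (T :\ b)].
  by move=> x y xD yD; rewrite /linked !h.
move=> bD eD; have [/setDP[eF eF'] /setDP[bF bF']] := (eD, bD).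
rewrite edges_minor // in_setI bD andbT; case: (boolP (b \in T)) => //= bT.
rewrite !in_setD in_setI in_setD eF eF' (subsetP sFG) // !andbT.
case: (boolP (e \in T)) => //= eT.
rewrite in_span_minor //; last first.
  by apply/subsetP => f; rewrite !inE => /and3P[_ _ /andP[]].
rewrite span_block_delete; last by rewrite inE bT.
congr (~~ _); apply/idP/idP => h.
  exact: subsetP (spanS _ (setSD _ (subsetIl _ _))) _ h.
exact: span_delete sT iT (subsetIl _ _) (subsetP spF _ eF) h.
Qed.

End TreesOfMinors.

(** ** Gluing *)

Section Gluing.
Variables (E : finType) (G : graph E).
Implicit Types (T F : {set E}).

Definition tree_in T F := spans_in G T F /\ indep G (T :&: F).

(** A basis of a contraction completes a basis of the contracted set: a
    dependency of an old element [f] would, after exchange against a new element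
    [g], put [g] in the span of the other elements. *)
Lemma tree_in_glue T F' F : F' \subset F -> F \subset edges G ->
  tree_in T F' -> spanning_tree (minor G F' F) (T :&: (F :\: F')) ->
  tree_in T F.
Proof.
move=> sF'F sFG [spF' iT'] /spanning_treeP[_ iTm spm].
have sAF U : T :&: (F :\: F') :\: U \subset F.
  by apply/subsetP => f; rewrite !inE => /and3P[_ _ /andP[]].
have sA : T :&: (F :\: F') \subset F by apply: subset_trans (subsetIr _ _) (subsetDl _ _).
rewrite edges_minor // in spm.
have new f : f \in T :&: (F :\: F') -> f \notin span G (F' :|: (T :&: (F :\: F')) :\ f).
  by move=> fA; rewrite -(@in_span_minor _ G F' F) ?sAF // ?iTm //; case/setIP: fA.
split.
  apply/subsetP => e eF; case: (boolP (e \in F')) => eF'.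
    by apply: subsetP (subsetP spF' _ eF'); apply/spanS/setIS.
  have eA : e \in F :\: F' by rewrite inE eF'.
  have := subsetP spm _ eA; rewrite in_span_minor //.
  rewrite -(span_block spF' (S := T :&: F)); last by rewrite setIC setIS.
  by apply: subsetP; apply/spanS/setUS/setIS/subsetDl.
move=> f /setIP[fT fF]; apply/negP => fsp.
case: (boolP (f \in F')) => fF'; last first.
  have /new/negP : f \in T :&: (F :\: F') by rewrite !inE fT fF' fF.
  apply; apply: subsetP fsp; apply/spanS/subsetP => g.
  by rewrite !inE => /and3P[-> -> ->]; rewrite andbT orbN.
pose P (S : {set E}) := (S \subset T :&: (F :\: F')) &&
  (f \in span G ((T :&: F') :\ f :|: S)).
have PA : P (T :&: (F :\: F')).
  rewrite /P subxx /=; apply: subsetP fsp; apply/spanS/subsetP => g.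
  by rewrite !inE => /and3P[-> -> ->]; case: (g \in F').
(* The new elements that really serve to span [f] form the minimal set [S]. *)
have [S /minsetP[/andP[sSA fS] minS] _] := minset_exists PA.
have /set0Pn[g gS] : S != set0.
  apply: contraNneq (iT' f _) => [S0|]; last by rewrite inE fT.
  by rewrite S0 setU0 in fS.
have gA := subsetP sSA _ gS; case/negP: (new g gA).
have gG : g \in edges G.
  by case/setIP: gA => _ /setDP[gF _]; apply: (subsetP sFG).
have nfS : f \notin span G ((T :&: F') :\ f :|: S :\ g).
  apply/negP => h; have PSg : P (S :\ g).
    by rewrite /P h andbT (subset_trans (subsetDl _ _) sSA).
  by have /setP/(_ g) := minS _ PSg (subsetDl _ _); rewrite !inE eqxx gS.
have : g \in span G (f |: ((T :&: F') :\ f :|: S :\ g)).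
  by apply: span_exchange nfS => //; rewrite setUCA setD1K.
apply: subsetP; apply/spanS/subsetP => h /setU1P[->|]; first by rewrite inE fF'.
case/setUP=> [/setD1P[_ /setIP[_ hF']]|/setD1P[nhg hS]]; rewrite in_setU.
  by rewrite hF'.
by rewrite in_setD1 nhg (subsetP sSA) ?orbT.
Qed.

End Gluing.

(** * Minima and ranks *)

Section Order.
Variables (d : Order.disp_t) (E : finOrderType d).
Implicit Types (A D : {set E}) (x y : E).

Lemma order_ind (P : E -> Prop) :
  (forall x, (forall y, (y < x)%O -> P y) -> P x) -> forall x, P x.
Proof.
move=> IH x; have [n] := ubnP #|[set y | (y < x)%O]|.
elim: n x => // n IHn x; rewrite ltnS => le_n; apply: IH => y yx.
apply: IHn; apply: leq_trans le_n; apply: proper_card; apply/properP; split.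
  by apply/subsetP => z; rewrite !inE => /lt_trans; apply.
by exists y; rewrite !inE ?ltxx.
Qed.

Lemma leastP A x : reflect (x \in A /\ {in A, forall y, (x <= y)%O}) (x \in least A).
Proof.
rewrite inE; apply: (iffP andP) => -[xA h]; split=> //.
  exact: forall_inP.
exact/forall_inP.
Qed.

Lemma least_set1 A x : x \in least A -> least A = [set x].
Proof.
move=> /leastP[xA xle]; apply/setP => y; rewrite in_set1.
apply/leastP/eqP => [[yA yle]|->]; last by split.
by apply/le_anti; rewrite xle ?yle.
Qed.

Lemma least_exists A : A != set0 -> exists x, x \in least A.
Proof.
case/set0Pn=> x xA; case: (@arg_minP _ _ _ x (mem A) id xA) => y yA yle.
by exists y; apply/leastP.
Qed.

Definition rank A x : nat := #|[set y in A | (y < x)%O]|.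

Lemma rank_lt A x y : x \in A -> (x < y)%O -> rank A x < rank A y.
Proof.
move=> xA xy; apply: proper_card; apply/properP; split.
  by apply/subsetP => z; rewrite !inE => /andP[-> /lt_trans]; apply.
by exists x; rewrite !inE xA ?ltxx.
Qed.

Lemma rank_inj A : {in A &, injective (rank A)}.
Proof.
move=> x y xA yA exy; case: (ltgtP x y) => // /rank_lt.
  by move=> /(_ _ xA); rewrite exy ltnn.
by move=> /(_ _ yA); rewrite exy ltnn.
Qed.

Lemma rank_ltn A x : x \in A -> rank A x < #|A|.
Proof.
move=> xA; apply: proper_card; apply/properP; split.
  by apply/subsetP => z; rewrite inE => /andP[].
by exists x; rewrite // !inE ltxx andbF.
Qed.

Lemma rank_exists A k : k < #|A| -> exists2 x, x \in A & rank A x = k.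
Proof.
case def_n: #|A| => [//|n] ltk.
pose f x : 'I_n.+1 := inord (rank A x).
have fE x : x \in A -> f x = rank A x :> nat.
  by move=> /rank_ltn; rewrite def_n => h; rewrite inordK.
have finj : {in A &, injective f}.
  by move=> x y xA yA /(congr1 val) /=; rewrite !fE // => /rank_inj; apply.
have /eqP fA : f @: A == setT.
  by rewrite eqEcard subsetT cardsT card_ord card_in_imset // def_n leqnn.
have : Ordinal ltk \in f @: A by rewrite fA inE.
by case/imsetP=> x xA /(congr1 val) /=; rewrite fE // => ->; exists x.
Qed.

Lemma rank_prefixS A a : a \in A ->
  [set x in A | rank A x < (rank A a).+1] = a |: [set x in A | rank A x < rank A a].
Proof.
move=> aA; apply/setP => x; rewrite !inE ltnS leq_eqVlt.
case: (eqVneq x a) => [->|nxa] /=; first by rewrite aA eqxx.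
case: (boolP (x \in A)) => //= xA; case: eqP => // rk_x.
by case/negP: nxa; apply/eqP; apply: (rank_inj xA aA); rewrite rk_x.
Qed.

Lemma rank_suffixS A a : a \in A ->
  [set x in A | rank A a <= rank A x] = a |: [set x in A | (rank A a).+1 <= rank A x].
Proof.
move=> aA; apply/setP => x; rewrite !inE leq_eqVlt.
case: (eqVneq x a) => [->|nxa] /=; first by rewrite aA eqxx.
case: (boolP (x \in A)) => //= xA; case: eqP => // rk_x.
by case/negP: nxa; apply/eqP; apply: (rank_inj xA aA); rewrite rk_x.
Qed.

(** The minima of the blocks list the active elements increasingly, so the
    position of a block can be recovered as a rank, from the set of active
    elements alone. *)
Lemma rank_least A n (D : nat -> {set E}) :
  (forall k, k < n -> D k != set0) -> min_increasing n D ->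
  (forall x, x \in A <-> exists2 k, k < n & x \in least (D k)) ->
  #|A| = n /\ forall k x, k < n -> x \in least (D k) -> rank A x = k.
Proof.
move=> D0 incr defA.
have /fin_all_exists[a aP] (k : 'I_n) : exists x, x \in least (D k).
  exact/least_exists/D0.
have aE k x (ltk : k < n) : x \in least (D k) -> x = a (Ordinal ltk).
  by move/least_set1=> lE; have := aP (Ordinal ltk); rewrite lE => /set1P.
have alt (i j : 'I_n) : i < j -> (a i < a j)%O.
  by move=> ltij; apply: (incr i j); rewrite ?aP // ltij ltn_ord.
have ainj : injective a.
  move=> i j aij; apply: val_inj; case: (ltngtP i j) => // /alt.
    by rewrite aij ltxx.
  by rewrite aij ltxx.
have Aim : A = [set a i | i : 'I_n].
  apply/setP => x; apply/idP/imsetP => [/defA[k ltk /(aE _ _ ltk) ->]|[k _ ->]].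
    by exists (Ordinal ltk).
  by apply/defA; exists k.
split=> [|k x ltk /(aE _ _ ltk)->]; first by rewrite Aim card_imset // card_ord.
pose b (j : 'I_k) := a (widen_ord (ltnW ltk) j).
have binj : injective b by move=> i j /ainj /(congr1 val) /= /val_inj.
rewrite -[RHS]card_ord -(card_imset _ binj); apply: eq_card => y; rewrite inE Aim.
apply/andP/imsetP => [[/imsetP[j _ ->] lta]|[j _ ->]].
  have ltjk : j < k.
    case: (ltngtP j k) lta => // [/(alt (Ordinal ltk))|ejk].
      by move=> /lt_trans h /h; rewrite ltxx.
    have -> : j = Ordinal ltk by apply: val_inj.
    by rewrite ltxx.
  by exists (Ordinal ltjk); rewrite // /b; congr a; apply: val_inj.
by split; [apply: imset_f | apply: alt; rewrite /= ltn_ord].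
Qed.

End Order.

(** * Activities in a bipartite graph *)

Section Activity.
Variables (d : Order.disp_t) (E : finOrderType d).
Variables (X T : {set E}) (r : rel E).
Hypotheses (rC : symmetric r) (rX : forall x y, r x y -> x \in X).
Hypothesis rT : forall x y, r x y -> (x \in T) != (y \in T).
Implicit Types (A B D F : {set E}) (x y : E).

Definition act D : {set E} :=
  [set x in D | [forall y in D, r x y ==> (x < y)%O]].

Lemma actP D x :
  reflect (x \in D /\ forall y, y \in D -> r x y -> (x < y)%O) (x \in act D).
Proof.
rewrite inE; apply: (iffP andP) => -[xD h]; split=> //.
  by move=> y yD rxy; have /forall_inP/(_ y yD) := h; rewrite rxy.
by apply/forall_inP => y yD; apply/implyP; apply: h.
Qed.

Lemma act_sub D : act D \subset D.
Proof. by apply/subsetP => x /actP[]. Qed.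

Lemma nact_smaller D x : x \in D -> x \notin act D ->
  exists y, [/\ y \in D, r x y & (y < x)%O].
Proof.
move=> xD; rewrite inE xD /= negb_forall_in => /exists_inP[y yD].
rewrite negb_imply -leNgt => /andP[rxy yx]; exists y; split=> //.
rewrite lt_neqAle yx andbT; apply/eqP => exy.
by have := rT rxy; rewrite exy eqxx.
Qed.

Lemma actS D D' x : D \subset D' -> x \in D -> x \in act D' -> x \in act D.
Proof.
move=> sDD' xD /actP[_ h]; apply/actP; split=> // y /(subsetP sDD'); exact: h.
Qed.

Lemma least_act D : least D \subset act D.
Proof.
apply/subsetP => x /leastP[xD xle]; apply/actP; split=> // y yD rxy.
rewrite lt_neqAle xle // andbT; apply/eqP => exy.
by have := rT rxy; rewrite exy eqxx.
Qed.

(** The minima of two parts without links between them are both active. *)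
Lemma act_two A : (forall x y, r x y -> x \in A -> y \in A) ->
  X :&: A != set0 -> X :\: A != set0 -> 1 < #|act X|.
Proof.
move=> stable /least_exists[x xl] /least_exists[y yl].
have [_ out] := actP _ _ (subsetP (least_act _) _ yl).
have [_ inn] := actP _ _ (subsetP (least_act _) _ xl).
have [/setIP[xX xA] _] := leastP _ _ xl; have [/setDP[yX yA] _] := leastP _ _ yl.
apply/card_gt1P; exists x, y; split; last by apply: contraNneq yA => <-.
  by apply/actP; split=> // z zX rxz; apply: inn => //; rewrite inE zX (stable x).
apply/actP; split=> // z zX ryz; apply: out => //; rewrite inE zX andbT.
by apply: contra yA; apply: stable; rewrite rC.
Qed.

Definition link_closed F := forall x y, r x y -> x \in F -> x \notin T -> y \in F.

Lemma closed_out F x y : link_closed F -> r x y -> x \in T -> x \notin F -> y \notin F.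
Proof.
move=> cF rxy xT; apply: contra => yF; apply: (cF y x) => //; first by rewrite rC.
by have := rT rxy; rewrite xT; case: (y \in T).
Qed.

(** The rule deciding membership in a set of a filtration: a nonactive element
    of [T] follows one of its smaller neighbours, and a nonactive element
    outside [T] requires all of them. Hence such a set is known, by induction
    along the order, from its active elements. *)
Definition step A F : {set E} :=
  [set x in X | if x \in act X then x \in A else
     if x \in T then [exists y in F, r x y && (y < x)%O]
     else [forall y, r x y && (y < x)%O ==> (y \in F)]].

Definition generated A : {set E} := fixset (step A).

Lemma step_mono A B F F' : A \subset B -> F \subset F' -> step A F \subset step B F'.
Proof.
move=> sAB sFF'; apply/subsetP => x; rewrite !(in_set, inE) => /andP[->] /=.
case: ifP => _; first exact: subsetP.
case: ifP => _.
  by case/exists_inP=> y yF h; apply/exists_inP; exists y; rewrite ?(subsetP sFF').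
move=> /forallP h; apply/forallP => y; apply/implyP => ryx.
by have /implyP := h y => /(_ ryx); apply: subsetP.
Qed.

Lemma generatedE A : generated A = step A (generated A).
Proof. by rewrite [in RHS]fixsetK // => F F'; apply: step_mono. Qed.

Lemma generated_unique A F : F = step A F -> F = generated A.
Proof.
move=> defF; apply/setP; apply: order_ind => x IHx.
rewrite defF generatedE !inE; congr (_ && _).
case: ifP => // _; case: ifP => _.
  by apply: eq_existsb => y; case: ltP => [/IHx->|]; rewrite ?andbF.
by apply: eq_forallb => y; case: ltP => [/IHx->|]; rewrite ?andbF.
Qed.

Lemma generated_sub A : generated A \subset X.
Proof. by apply/subsetP => x; rewrite generatedE inE => /andP[]. Qed.

Lemma generated_act A x : x \in act X -> (x \in generated A) = (x \in A).
Proof.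
by move=> xa; rewrite generatedE inE xa (subsetP (act_sub X)).
Qed.

Lemma mem_generated A x : (x \in generated A) = (x \in step A (generated A)).
Proof. by rewrite -generatedE. Qed.

Lemma generated_inT A x : x \in X -> x \notin act X -> x \in T ->
  reflect (exists y, [/\ y \in generated A, r x y & (y < x)%O]) (x \in generated A).
Proof.
move=> xX /negPf xa xT; rewrite mem_generated inE xX xa xT.
apply: (iffP exists_inP) => [[y yF /andP[rxy yx]]|[y [yF rxy yx]]].
  by exists y.
by exists y; rewrite // rxy.
Qed.

Lemma generated_outT A x : x \in X -> x \notin act X -> x \notin T ->
  reflect (forall y, r x y -> (y < x)%O -> y \in generated A) (x \in generated A).
Proof.
move=> xX /negPf xa /negPf xT; rewrite mem_generated inE xX xa xT.
apply: (iffP forallP) => h y.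
  by move=> rxy yx; have /implyP := h y; rewrite rxy yx; apply.
by apply/implyP => /andP[]; apply: h.
Qed.

Lemma act_smaller x y : r x y -> (y < x)%O -> x \notin act X.
Proof.
move=> rxy yx; have yX : y \in X by apply: (rX (y := x)); rewrite rC.
by apply/negP => /actP[_ /(_ y yX rxy)]; rewrite (lt_gtF yx).
Qed.

(** A link between [x] and [y] makes the larger of the two nonactive, so that
    the rule applies to it. *)
Lemma generated_closed A : link_closed (generated A).
Proof.
move=> x y rxy xF xT; have xX := rX rxy.
have ryx : r y x by rewrite rC.
have yT : y \in T by have := rT rxy; rewrite (negPf xT); case: (y \in T).
case: (ltgtP y x) => [yx|xy|exy].
- by have /generated_outT := xF; apply=> //; apply: act_smaller yx.
- by apply/generated_inT=> //; [exact: rX ryx|exact: act_smaller xy|exists x].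
- by rewrite exy.
Qed.

Lemma generatedS A B : A \subset B -> generated A \subset generated B.
Proof.
move=> sAB; apply/subsetP; apply: order_ind => x IHx xF.
have xX := subsetP (generated_sub _) _ xF.
case: (boolP (x \in act X)) => xa.
  by move: xF; rewrite !generated_act //; apply: (subsetP sAB).
case: (boolP (x \in T)) => xT.
  have /generated_inT[//|//|//|y [yA rxy yx]] := xF.
  by apply/generated_inT => //; exists y; split=> //; apply: IHx.
apply/generated_outT => // y rxy yx; apply: IHx => //.
by have /generated_outT := xF; apply.
Qed.

Lemma generated0 : generated set0 = set0.
Proof.
apply/esym/generated_unique/setP => x; rewrite [RHS]inE !in_set0.
case: (boolP (x \in X)) => //= xX; case: ifP => // /negbT xa.
have [y [yX rxy yx]] := nact_smaller xX xa.
case: ifP => _; first by apply/esym/negbTE/negP => /exists_inP[z]; rewrite in_set0.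
by apply/esym/negbTE/negP => /forallP/(_ y); rewrite rxy yx in_set0.
Qed.

Lemma generatedX : generated (act X) = X.
Proof.
apply/esym/generated_unique/setP => x; rewrite [RHS]inE.
case: (boolP (x \in X)) => //= xX; case: ifP => // /negbT xa.
have [y [yX rxy yx]] := nact_smaller xX xa.
case: ifP => _; first by apply/esym/exists_inP; exists y; rewrite ?rxy.
by apply/esym/forallP => z; apply/implyP => /andP[]; rewrite rC => /rX.
Qed.

(** Adding one active element [a] adds a block in which each other element has
    a smaller neighbour in the block. *)
Lemma generated_block A a (D := generated (a |: A) :\: generated A) :
  a \in act X -> a \notin A -> a \in D /\ act D = [set a] /\ least D = [set a].
Proof.
move=> aX aA.
have aD : a \in D by rewrite inE !generated_act // setU11 andbT.
have down x : x \in D -> x != a -> exists y, [/\ y \in D, r x y & (y < x)%O].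
  case/setDP=> x1 x0 nxa; have xX := subsetP (generated_sub _) _ x1.
  have xa : x \notin act X.
    apply: contra x0 => xa; move: x1; rewrite !generated_act //.
    by rewrite in_setU1 (negPf nxa).
  case: (boolP (x \in T)) => xT.
    have /generated_inT[//|//|//|y [y1 rxy yx]] := x1.
    exists y; split=> //; rewrite inE y1 andbT; apply: contra x0 => y0.
    by apply/generated_inT => //; exists y.
  have [y yx y0] : exists2 y, r x y && (y < x)%O & y \notin generated A.
    apply/exists_inP; apply: contraR x0; rewrite negb_exists_in => /forall_inP h.
    apply/generated_outT => // y rxy yx; apply/negPn.
    by have := h y; rewrite /= rxy yx => /(_ isT).
  case/andP: yx => rxy yx; exists y; split=> //; rewrite inE y0 /=.
  by have /generated_outT := x1; apply.
have [z zl] : exists z, z \in least D by apply: least_exists; apply/set0Pn; exists a.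
have za : z = a.
  apply/eqP/negPn/negP => nza; have [zD zle] := leastP _ _ zl.
  by have [y [yD _]] := down z zD nza; rewrite ltNge zle.
have lD : least D = [set a] by rewrite -za; apply: least_set1.
split=> //; split=> //; apply/setP => x; rewrite in_set1; apply/idP/eqP => [|->].
  move=> /actP[xD h]; apply/eqP/negPn/negP => nxa.
  have [y [yD rxy yx]] := down x xD nxa.
  by have := h y yD rxy; rewrite (lt_gtF yx).
by apply: (subsetP (least_act D)); rewrite lD set11.
Qed.

(** An element that is not active in [X] has a smaller neighbour in its own
    block, hence on the same side of [F]; with closure under links this is the
    membership rule. *)
Lemma generated_of_blocks F : F \subset X -> link_closed F ->
  (forall x, x \in X -> exists D, [/\ x \in D, D \subset X, act D \subset act X &
     D \subset F \/ [disjoint D & F]]) ->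
  F = generated (act X :&: F).
Proof.
move=> sFX cF blocks; apply: generated_unique; apply/setP => x; rewrite [RHS]inE.
case: (boolP (x \in X)) => [xX|] /=; last by apply: contraNF; apply: (subsetP sFX).
case: ifP => [xa|/negbT xa]; first by rewrite inE xa.
have [D [xD sDX aD DF]] := blocks x xX.
have [y [yD rxy yx]] : exists y, [/\ y \in D, r x y & (y < x)%O].
  by apply: nact_smaller => //; apply: contra xa; apply: (subsetP aD).
case: ifP => [xT|/negbT xT].
  apply/idP/exists_inP => [xF|[z zF /andP[rxz _]]].
    exists y; last by rewrite rxy.
    case: DF => [sDF|/pred0P/(_ x)]; first exact: subsetP yD.
    by rewrite /= xD xF.
  by apply/negPn/negP => xF; move: (closed_out cF rxz xT xF); rewrite zF.
apply/idP/forallP => [xF z|/(_ y)].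
  by apply/implyP => /andP[rxz _]; apply: cF rxz _ _.
rewrite rxy yx /= => yF; case: DF => [sDF|/pred0P/(_ y)]; first exact: subsetP xD.
by rewrite /= yD yF.
Qed.

End Activity.

(** * Filtrations *)

Section Chains.
Variable E : finType.
Implicit Types (f : nat -> {set E}) (x : E).

Lemma increasing_chain f n : (forall k, k < n -> f k \subset f k.+1) ->
  forall k l, k <= l -> l <= n -> f k \subset f l.
Proof.
move=> incr k; elim=> [|l IHl]; first by rewrite leqn0 => /eqP->.
rewrite leq_eqVlt => /predU1P[->//|ltkl] ltln.
exact: subset_trans (IHl ltkl (ltnW ltln)) (incr l ltln).
Qed.

Lemma decreasing_chain f n : (forall k, k < n -> f k.+1 \subset f k) ->
  forall k l, k <= l -> l <= n -> f l \subset f k.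
Proof.
move=> decr k l lekl leln; rewrite -setCS.
apply: (@increasing_chain (fun k => ~: f k) n) => // i /decr.
by rewrite setCS.
Qed.

Lemma chain_enter f m n x : m <= n -> x \notin f m -> x \in f n ->
  exists k, [/\ m <= k, k < n & x \in f k.+1 :\: f k].
Proof.
move=> + xm; elim: n => [|n IHn]; first by rewrite leqn0 => /eqP <-; rewrite (negPf xm).
rewrite leq_eqVlt => /predU1P[<-|lemn] xn; first by rewrite (negPf xm) in xn.
case: (boolP (x \in f n)) => xn'; last by exists n; rewrite inE xn xn'.
by have [k [lemk ltkn xk]] := IHn lemn xn'; exists k; split=> //; apply: ltnW.
Qed.

Lemma chain_leave f m n x : m <= n -> x \in f m -> x \notin f n ->
  exists k, [/\ m <= k, k < n & x \in f k :\: f k.+1].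
Proof.
move=> lemn xm xn; have xm' : x \notin ~: f m by rewrite inE xm.
have xn' : x \in ~: f n by rewrite inE.
have [k [lemk ltkn]] := @chain_enter (fun k => ~: f k) m n x lemn xm' xn'.
rewrite !in_setD !in_setC negbK => xk.
by exists k; split=> //; rewrite in_setD andbC.
Qed.

End Chains.

Section Filtrations.
Variables (d : Order.disp_t) (E : finOrderType d) (G : graph E).
Variables (T : {set E}) (r : rel E).
Hypotheses (rC : symmetric r) (rX : forall x y, r x y -> x \in edges G).
Hypothesis rT : forall x y, r x y -> (x \in T) != (y \in T).
Implicit Types (Phi : filtration E) (F : {set E}).

(** What being a filtration with suitable spanning trees says about the
    fundamental graph of [T]. *)
Definition adapted Phi : Prop :=
  [/\ is_filtration G Phi,
      forall k, k <= iota_of Phi -> link_closed T r (Fup Phi k),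
      forall k, k <= eps_of Phi -> link_closed T r (Fdn Phi k),
      forall k, k < iota_of Phi -> #|act r (up_diff Phi k) :&: T| = 1 /\
                                   #|act r (up_diff Phi k) :\: T| = 0 &
      forall k, k < eps_of Phi -> #|act r (dn_diff Phi k) :&: T| = 0 /\
                                  #|act r (dn_diff Phi k) :\: T| = 1].

Lemma Fup_mono Phi k l : is_filtration G Phi -> k <= l -> l <= iota_of Phi ->
  Fup Phi k \subset Fup Phi l.
Proof.
by case=> _ _ incr _ _; apply: increasing_chain => i /incr /proper_sub.
Qed.

Lemma Fdn_mono Phi k l : is_filtration G Phi -> k <= l -> l <= eps_of Phi ->
  Fdn Phi l \subset Fdn Phi k.
Proof.
by case=> _ decr _ _ _; apply: decreasing_chain => i /decr /proper_sub.
Qed.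

Lemma Fup_edges Phi k : is_filtration G Phi -> k <= iota_of Phi ->
  Fup Phi k \subset edges G.
Proof. by move=> fPhi lek; have [[_ <-] _ _ _ _] := fPhi; apply: Fup_mono. Qed.

Lemma Fdn_Fup Phi k l : is_filtration G Phi -> k <= eps_of Phi ->
  l <= iota_of Phi -> Fdn Phi k \subset Fup Phi l.
Proof.
move=> fPhi lek lel; apply: subset_trans (Fup_mono fPhi (leq0n l) lel).
exact: Fdn_mono fPhi (leq0n k) lek.
Qed.

Lemma Fdn_edges Phi k : is_filtration G Phi -> k <= eps_of Phi ->
  Fdn Phi k \subset edges G.
Proof.
move=> fPhi lek; apply: subset_trans (Fup_edges fPhi (leq0n _)).
exact: Fdn_Fup.
Qed.

Lemma up_diff0 Phi k : is_filtration G Phi -> k < iota_of Phi -> up_diff Phi k != set0.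
Proof.
by case=> _ _ incr _ _ /incr /properP[_ [x x1 x0]]; apply/set0Pn; exists x; rewrite inE x0.
Qed.

Lemma dn_diff0 Phi k : is_filtration G Phi -> k < eps_of Phi -> dn_diff Phi k != set0.
Proof.
by case=> _ decr _ _ _ /decr /properP[_ [x x1 x0]]; apply/set0Pn; exists x; rewrite inE x0.
Qed.

Lemma filtration_cover Phi x : is_filtration G Phi -> x \in edges G ->
  (exists2 k, k < iota_of Phi & x \in up_diff Phi k) \/
  (exists2 k, k < eps_of Phi & x \in dn_diff Phi k).
Proof.
case=> -[dn0 upX] _ _ _ _; rewrite -upX => xX.
case: (boolP (x \in Fup Phi 0)) => x0.
  right; have [|k [_ ltk xk]] := @chain_leave _ (Fdn Phi) 0 _ x (leq0n (eps_of Phi)) x0.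
    by rewrite dn0 inE.
  by exists k.
by left; have [k [_ ltk xk]] := chain_enter (leq0n _) x0 xX; exists k.
Qed.

Section Adapted.
Variable Phi : filtration E.
Hypothesis aPhi : adapted Phi.

Let fPhi : is_filtration G Phi.
Proof. by case: aPhi. Qed.

Lemma up_act k : k < iota_of Phi ->
  act r (up_diff Phi k) = least (up_diff Phi k) /\ least (up_diff Phi k) \subset T.
Proof.
case: aPhi => _ _ _ up _ ltk; have [/eqP c1 /eqP] := up k ltk.
rewrite cards_eq0 setD_eq0 => sT; rewrite (setIidPl sT) in c1.
have [x xl] := least_exists (up_diff0 fPhi ltk).
case/cards1P: c1 => y def_y; have := subsetP (least_act rT _) _ xl.
rewrite def_y => /set1P exy; rewrite (least_set1 xl) exy -def_y.
by split=> //; rewrite def_y.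
Qed.

Lemma dn_act k : k < eps_of Phi ->
  act r (dn_diff Phi k) = least (dn_diff Phi k) /\ [disjoint least (dn_diff Phi k) & T].
Proof.
case: aPhi => _ _ _ _ dn ltk; have [/eqP + /eqP c1] := dn k ltk.
rewrite cards_eq0 setI_eq0 => dT; rewrite (setDidPl dT) in c1.
have [x xl] := least_exists (dn_diff0 fPhi ltk).
case/cards1P: c1 => y def_y; have := subsetP (least_act rT _) _ xl.
by rewrite def_y => /set1P exy; rewrite (least_set1 xl) exy -def_y.
Qed.

(** The minimum of an upper block lies in [T], so its neighbours are in that
    block or in the later ones, whose minima are larger. *)
Lemma up_least_act k : k < iota_of Phi -> least (up_diff Phi k) \subset act r (edges G).
Proof.
move=> ltk; apply/subsetP => x xl; have [xD xle] := leastP _ _ xl.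
have [_ /subsetP/(_ x xl) xT] := up_act ltk.
have [x1 x0] := setDP xD.
apply/actP; split=> [|y yX rxy]; first exact: subsetP (Fup_edges fPhi ltk) _ x1.
have yF : y \notin Fup Phi k.
  by apply: (closed_out rC rT _ rxy xT x0); case: aPhi => _ up _ _ _; apply/up/ltnW.
have [[_ upX] _ _ incr _] := fPhi; rewrite -upX in yX.
have [l [lekl ltl yl]] := chain_enter (ltnW ltk) yF yX.
have [z zl] := least_exists (up_diff0 fPhi ltl); have [_ zle] := leastP _ _ zl.
move: lekl; rewrite leq_eqVlt => /predU1P[ekl|ltkl].
  rewrite lt_neqAle xle ?andbT; last by rewrite ekl.
  by apply: contraTneq (rT rxy) => ->; rewrite eqxx.
by apply: lt_le_trans (zle y yl); apply: (incr k l); rewrite ?ltkl.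
Qed.

(** Dually, the minimum of a lower block lies outside [T], so its neighbours are
    in the set [Fdn Phi k], hence in that block or in the inner ones. *)
Lemma dn_least_act k : k < eps_of Phi -> least (dn_diff Phi k) \subset act r (edges G).
Proof.
move=> ltk; apply/subsetP => x xl; have [xD xle] := leastP _ _ xl.
have [_ /pred0P/(_ x)] := dn_act ltk; rewrite /= xl /= => /negbT xT.
have [x1 x0] := setDP xD.
apply/actP; split=> [|y yX rxy]; first exact: subsetP (Fdn_edges fPhi (ltnW ltk)) _ x1.
have yF : y \in Fdn Phi k.
  by case: aPhi => _ _ dn _ _; apply: dn (ltnW ltk) _ _ rxy x1 xT.
have [[dnX _] _ _ _ incr] := fPhi.
have [|l [lekl ltl yl]] := chain_leave (ltnW ltk) yF; first by rewrite dnX inE.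
have [z zl] := least_exists (dn_diff0 fPhi ltl); have [_ zle] := leastP _ _ zl.
move: lekl; rewrite leq_eqVlt => /predU1P[ekl|ltkl].
  rewrite lt_neqAle xle ?andbT; last by rewrite ekl.
  by apply: contraTneq (rT rxy) => ->; rewrite eqxx.
by apply: lt_le_trans (zle y yl); apply: (incr k l); rewrite ?ltkl.
Qed.

Lemma act_up x : x \in act r (edges G) -> x \in T ->
  exists2 k, k < iota_of Phi & x \in least (up_diff Phi k).
Proof.
move=> xa xT; have xX := subsetP (act_sub _ _) _ xa.
case: (filtration_cover fPhi xX) => -[k ltk xk].
  exists k => //; have [<- _] := up_act ltk; apply: actS xa => //.
  by apply: subset_trans (Fup_edges fPhi ltk); apply: subsetDl.
have [eq_act /pred0P/(_ x) /negP[]] := dn_act ltk; rewrite /= xT andbT -eq_act.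
apply: actS xa => //; apply: subset_trans (Fdn_edges fPhi (ltnW ltk)).
exact: subsetDl.
Qed.

Lemma act_dn x : x \in act r (edges G) -> x \notin T ->
  exists2 k, k < eps_of Phi & x \in least (dn_diff Phi k).
Proof.
move=> xa xT; have xX := subsetP (act_sub _ _) _ xa.
case: (filtration_cover fPhi xX) => -[k ltk xk]; last first.
  exists k => //; have [<- _] := dn_act ltk; apply: actS xa => //.
  by apply: subset_trans (Fdn_edges fPhi (ltnW ltk)); apply: subsetDl.
have [eq_act sT] := up_act ltk; case/negP: xT; apply: (subsetP sT).
rewrite -eq_act; apply: actS xa => //; apply: subset_trans (Fup_edges fPhi ltk).
exact: subsetDl.
Qed.

Lemma adapted_int x : x \in act r (edges G) :&: T <->
  exists2 k, k < iota_of Phi & x \in least (up_diff Phi k).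
Proof.
split=> [/setIP[]|[k ltk xl]]; first exact: act_up.
rewrite inE (subsetP (up_least_act ltk)) //.
by have [_ /subsetP->] := up_act ltk.
Qed.

Lemma adapted_ext x : x \in act r (edges G) :\: T <->
  exists2 k, k < eps_of Phi & x \in least (dn_diff Phi k).
Proof.
split=> [/setDP[]|[k ltk xl]]; first exact: act_dn.
rewrite inE (subsetP (dn_least_act ltk)) // andbT.
by have [_ /pred0P/(_ x)] := dn_act ltk; rewrite /= xl => /negbT.
Qed.

Lemma adapted_blocks x : x \in edges G ->
  exists D : {set E}, [/\ x \in D, D \subset edges G,
  act r D \subset act r (edges G) &
  (forall k, k <= iota_of Phi -> D \subset Fup Phi k \/ [disjoint D & Fup Phi k]) /\
  (forall k, k <= eps_of Phi -> D \subset Fdn Phi k \/ [disjoint D & Fdn Phi k])].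
Proof.
move=> xX; have dis (A B C : {set E}) : C \subset B -> [disjoint A :\: B & C].
  move=> sCB; apply/pred0P => z /=; rewrite inE andbAC.
  by case: (boolP (z \in C)) => [/(subsetP sCB)->|]; rewrite ?andbF.
case: (filtration_cover fPhi xX) => -[k ltk xk].
  exists (up_diff Phi k); split=> //.
  - by apply: subset_trans (Fup_edges fPhi ltk); apply: subsetDl.
  - by have [-> _] := up_act ltk; apply: up_least_act.
  split=> l lel.
    case: (ltnP k l) => [ltkl|lelk]; last by right; apply/dis/Fup_mono/ltnW.
    by left; apply: subset_trans (subsetDl _ _) (Fup_mono fPhi ltkl lel).
  by right; apply/dis/Fdn_Fup => //; apply: ltnW.
exists (dn_diff Phi k); split=> //.
- by apply: subset_trans (Fdn_edges fPhi (ltnW ltk)); apply: subsetDl.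
- by have [-> _] := dn_act ltk; apply: dn_least_act.
split=> l lel.
  by left; apply: subset_trans (subsetDl _ _) (Fdn_Fup fPhi (ltnW ltk) lel).
case: (ltnP k l) => [ltkl|lelk]; first by right; apply/dis/Fdn_mono.
by left; apply: subset_trans (subsetDl _ _) (Fdn_mono fPhi lelk (ltnW ltk)).
Qed.

End Adapted.

(** ** The filtration of a spanning tree *)

Definition int_of : {set E} := act r (edges G) :&: T.
Definition ext_of : {set E} := act r (edges G) :\: T.

(** Positions in the filtration are ranks of active elements: the sets above
    the core receive the internally active elements by increasing rank, and those
    below lose the externally active ones by increasing rank. *)
Definition up_of (k : nat) : {set E} :=
  generated (edges G) T r (ext_of :|: [set x in int_of | rank int_of x < k]).
Definition dn_of (k : nat) : {set E} :=
  generated (edges G) T r [set x in ext_of | k <= rank ext_of x].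

Definition filtration_of : filtration E :=
  Filtration (up_of 0) (mkseq (fun k => up_of k.+1) #|int_of|)
    (mkseq (fun k => dn_of k.+1) #|ext_of|).

(** The ranks of the active elements, hence the active elements of each member
    of the filtration, hence the members themselves, are determined. *)
Lemma adapted_unique Phi : adapted Phi -> Phi = filtration_of.
Proof.
move=> aPhi; have [fPhi cup cdn _ _] := aPhi; have [_ _ _ iup idn] := fPhi.
have [ci ri] := rank_least (fun k => up_diff0 fPhi (k := k)) iup (adapted_int aPhi).
have [ce re] := rank_least (fun k => dn_diff0 fPhi (k := k)) idn (adapted_ext aPhi).
have intE k x : k <= iota_of Phi -> x \in int_of -> (x \in Fup Phi k) = (rank int_of x < k).
  move=> lek /(adapted_int aPhi)[l ltl xl]; rewrite (ri l) //.
  have /leastP[/setDP[x1 x0] _] := xl.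
  case: (ltnP l k) => [ltlk|lekl]; first exact: subsetP (Fup_mono fPhi ltlk lek) _ x1.
  by apply: contraNF x0; apply/subsetP/(Fup_mono fPhi lekl)/ltnW.
have extE k x : k <= eps_of Phi -> x \in ext_of -> (x \in Fdn Phi k) = (k <= rank ext_of x).
  move=> lek /(adapted_ext aPhi)[l ltl xl]; rewrite (re l) //.
  have /leastP[/setDP[x1 x0] _] := xl.
  case: (leqP k l) => [lekl|ltlk]; first exact: subsetP (Fdn_mono fPhi lekl (ltnW ltl)) _ x1.
  by apply: contraNF x0; apply/subsetP/(Fdn_mono fPhi ltlk).
have upE k : k <= iota_of Phi -> Fup Phi k = up_of k.
  move=> lek; rewrite {1}(generated_of_blocks rC rT (Fup_edges fPhi lek) (cup k lek)).
    congr generated; apply/setP => x; rewrite in_setI in_setU in_set.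
    case: (boolP (x \in act r (edges G))) => [xa|xa] /=; last first.
      by rewrite in_setD in_setI (negPf xa) andbF.
    case: (boolP (x \in T)) => xT.
      have xi : x \in int_of by rewrite in_setI xa.
      by rewrite intE // xi in_setD xT.
    have xe : x \in ext_of by rewrite in_setD xT.
    rewrite xe; have [l ltl xl] := act_dn aPhi xa xT.
    apply: subsetP (Fdn_Fup fPhi (ltnW ltl) lek) _ _.
    by have /leastP[/setDP[]] := xl.
  move=> x xX; have [D [xD sD aD [D1 _]]] := adapted_blocks aPhi xX.
  by exists D; split=> //; apply: D1.
have dnE k : k <= eps_of Phi -> Fdn Phi k = dn_of k.
  move=> lek; rewrite {1}(generated_of_blocks rC rT (Fdn_edges fPhi lek) (cdn k lek)).
    congr generated; apply/setP => x; rewrite in_setI in_set.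
    case: (boolP (x \in act r (edges G))) => [xa|xa] /=; last first.
      by rewrite in_setD (negPf xa) andbF.
    case: (boolP (x \in T)) => xT; last first.
      have xe : x \in ext_of by rewrite in_setD xT.
      by rewrite extE // xe.
    rewrite in_setD xT /=; have [l ltl xl] := act_up aPhi xa xT.
    have /leastP[/setDP[_ x0] _] := xl.
    by apply: contraNF x0; apply/subsetP/Fdn_Fup => //; apply: ltnW.
  move=> x xX; have [D [xD sD aD [_ D1]]] := adapted_blocks aPhi xX.
  by exists D; split=> //; apply: D1.
case: (Phi) ci ce upE dnE => C A B /= ci ce upE dnE; congr Filtration.
- exact: (upE 0).
- apply: (@eq_from_nth _ set0) => [|k ltk]; first by rewrite size_mkseq ci.
  by rewrite nth_mkseq ?ci //; apply: (upE k.+1).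
- apply: (@eq_from_nth _ set0) => [|k ltk]; first by rewrite size_mkseq ce.
  by rewrite nth_mkseq ?ce //; apply: (dnE k.+1).
Qed.

Lemma iota_filtration_of : iota_of filtration_of = #|int_of|.
Proof. by rewrite /iota_of size_mkseq. Qed.

Lemma eps_filtration_of : eps_of filtration_of = #|ext_of|.
Proof. by rewrite /eps_of size_mkseq. Qed.

Lemma Fup_filtration_of k : k <= #|int_of| -> Fup filtration_of k = up_of k.
Proof. by case: k => // k ltk; rewrite /Fup /= nth_mkseq. Qed.

Lemma Fdn_filtration_of k : k <= #|ext_of| -> Fdn filtration_of k = dn_of k.
Proof.
case: k => [_|k ltk]; last by rewrite /Fdn /= nth_mkseq.
rewrite /Fdn /= /up_of /dn_of; congr generated; apply/setP => x.
by rewrite in_setU !in_set ltn0 !andbF orbF leq0n !andbT.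
Qed.

Lemma up_of_block k : k < #|int_of| -> exists2 a, a \in int_of & rank int_of a = k /\
  [/\ a \in up_of k.+1 :\: up_of k, act r (up_of k.+1 :\: up_of k) = [set a] &
      least (up_of k.+1 :\: up_of k) = [set a]].
Proof.
move=> /rank_exists[a ai <-]; exists a => //; split=> //.
have [aX aT] := setIP ai.
rewrite /up_of rank_prefixS // setUCA.
set A := ext_of :|: _; have [||? []] := @generated_block _ _ (edges G) T r rT A a => //.
by rewrite !inE aT ltnn andbF.
Qed.

Lemma dn_of_block k : k < #|ext_of| -> exists2 a, a \in ext_of & rank ext_of a = k /\
  [/\ a \in dn_of k :\: dn_of k.+1, act r (dn_of k :\: dn_of k.+1) = [set a] &
      least (dn_of k :\: dn_of k.+1) = [set a]].
Proof.
move=> /rank_exists[a ai <-]; exists a => //; split=> //.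
have [aX aT] := setDP ai.
rewrite /dn_of rank_suffixS //; set A := [set x in _ | (rank _ a).+1 <= _].
have [||? []] := @generated_block _ _ (edges G) T r rT A a => //.
by rewrite !inE ltnn andbF.
Qed.

Lemma adapted_filtration_of : adapted filtration_of.
Proof.
have upE k : k < iota_of filtration_of -> up_diff filtration_of k = up_of k.+1 :\: up_of k.
  by rewrite iota_filtration_of => ltk; rewrite /up_diff !Fup_filtration_of // ltnW.
have dnE k : k < eps_of filtration_of -> dn_diff filtration_of k = dn_of k :\: dn_of k.+1.
  by rewrite eps_filtration_of => ltk; rewrite /dn_diff !Fdn_filtration_of // ltnW.
split; first split.
- rewrite iota_filtration_of eps_filtration_of Fup_filtration_of // Fdn_filtration_of //.
  split.
    rewrite /dn_of (_ : [set x in _ | _] = set0) ?generated0 //.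
    apply/setP => x; rewrite in_set0 in_set; case: (boolP (x \in ext_of)) => //= xe.
    by rewrite leqNgt rank_ltn.
  rewrite /up_of (_ : _ :|: _ = act r (edges G)) ?generatedX //.
  apply/setP => x; rewrite in_setU in_set.
  case: (boolP (x \in int_of)) => xi /=.
    by rewrite rank_ltn // orbT; case/setIP: xi => ->.
  rewrite orbF inE; case: (boolP (x \in T)) => //= xT; apply/esym/negbTE.
  by apply: contra xi => xa; rewrite inE xa.
- move=> k; rewrite eps_filtration_of => ltk; rewrite !Fdn_filtration_of //; last exact: ltnW.
  have [a _ [_ [/setDP[a1 a0] _ _]]] := dn_of_block ltk.
  apply/properP; split; last by exists a.
  apply: generatedS => //; apply/subsetP => x; rewrite !in_set => /andP[-> /ltnW->].
  by rewrite andbT.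
- move=> k; rewrite iota_filtration_of => ltk; rewrite !Fup_filtration_of //; last exact: ltnW.
  have [a _ [_ [/setDP[a1 a0] _ _]]] := up_of_block ltk.
  apply/properP; split; last by exists a.
  apply: generatedS => //; apply/setUS/subsetP => x; rewrite !in_set => /andP[->] /=.
  exact: ltnW.
- move=> k l x y /andP[ltkl ltl]; rewrite !upE //; last exact: ltn_trans ltl.
  rewrite iota_filtration_of in ltl.
  have [a ai [rk_a [_ _ ->]]] := up_of_block (ltn_trans ltkl ltl).
  have [b bi [rk_b [_ _ ->]]] := up_of_block ltl.
  move=> /set1P-> /set1P->; case: (ltgtP a b) => // [/(rank_lt bi)|eab].
    by rewrite rk_a rk_b ltnNge ltnW.
  by rewrite -rk_a -rk_b eab ltnn in ltkl.
- move=> k l x y /andP[ltkl ltl]; rewrite !dnE //; last exact: ltn_trans ltl.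
  rewrite eps_filtration_of in ltl.
  have [a ai [rk_a [_ _ ->]]] := dn_of_block (ltn_trans ltkl ltl).
  have [b bi [rk_b [_ _ ->]]] := dn_of_block ltl.
  move=> /set1P-> /set1P->; case: (ltgtP a b) => // [/(rank_lt bi)|eab].
    by rewrite rk_a rk_b ltnNge ltnW.
  by rewrite -rk_a -rk_b eab ltnn in ltkl.
- move=> k; rewrite iota_filtration_of => lek.
  by rewrite Fup_filtration_of //; apply: generated_closed.
- move=> k; rewrite eps_filtration_of => lek.
  by rewrite Fdn_filtration_of //; apply: generated_closed.
- move=> k ltk; rewrite upE //; rewrite iota_filtration_of in ltk.
  have [a /setIP[_ aT] [_ [_ -> _]]] := up_of_block ltk.
  have sa : [set a] \subset T by rewrite sub1set.
  by rewrite (setIidPl sa) cards1; split=> //; apply/eqP; rewrite cards_eq0 setD_eq0.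
- move=> k ltk; rewrite dnE //; rewrite eps_filtration_of in ltk.
  have [a /setDP[_ aT] [_ [_ -> _]]] := dn_of_block ltk.
  have da : [disjoint [set a] & T] by rewrite disjoints1.
  by rewrite (setDidPl da) cards1; split=> //; apply/eqP; rewrite cards_eq0 setI_eq0.
Qed.

End Filtrations.

(** * Activities of spanning trees *)

Section TreeActivity.
Variables (d : Order.disp_t) (E : finOrderType d) (H : graph E) (T : {set E}).
Hypothesis tT : spanning_tree H T.

Let actH := act (linked H T) (edges H).

Lemma linked_edges x y : linked H T x y -> x \in edges H.
Proof.
have /spanning_treeP[/subsetP sT _ _] := tT.
by case/orP=> /and3P[]; [move/sT | move=> _ /setDP[]].
Qed.

Lemma least_linked x : x \in edges H ->
  (x \in least (x |: [set y | linked H T x y])) = (x \in actH).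
Proof.
move=> xH; apply/leastP/actP => [[_ xle]|[_ xlt]]; split=> //; rewrite ?setU11 // => y.
  move=> _ rxy; rewrite lt_neqAle xle ?andbT; last by rewrite !inE rxy orbT.
  by apply: contraTneq (linked_side rxy) => ->; rewrite eqxx.
case/setU1P=> [->//|]; rewrite inE => rxy; apply/ltW/xlt => //.
by apply: (@linked_edges y x); rewrite linkedC.
Qed.

Lemma int_actE : int_act H T = actH :&: T.
Proof.
have /spanning_treeP[/subsetP sT _ _] := tT.
apply/setP => b; rewrite [LHS]in_set in_setI andbC.
case: (boolP (b \in T)) => bT; rewrite ?andbF //= !andbT.
by rewrite fund_cocycleE // least_linked // sT.
Qed.

Lemma ext_actE : ext_act H T = actH :\: T.
Proof.
apply/setP => e; rewrite [LHS]in_set [RHS]in_setD.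
case: (boolP (e \in edges H :\: T)) => eHT /=.
  by have [eH eT] := setDP eHT; rewrite fund_cycleE // least_linked // eT.
apply/esym/negbTE; apply: contra eHT => /andP[eT /(subsetP (act_sub _ _)) eH].
by rewrite inE eT.
Qed.

(** ** Blocks *)

(** If all edges leaving [K] go to one vertex [v], the edges touching [K] are
    not linked to the others: collapsing the vertices on one side to [v] turns
    a path of [T] into a path using only the edges of the other side. *)
Lemma vertex_separation (K : {set vertex H}) v : v \notin K ->
  (forall x y, adj x y -> x \in K -> y \in v |: K) ->
  (exists2 e, e \in edges H & ((ends H e).1 \in K) || ((ends H e).2 \in K)) ->
  (exists2 e, e \in edges H & ((ends H e).1 \notin K) && ((ends H e).2 \notin K)) ->
  1 < #|actH|.
Proof.
move=> vK adjK [e1 e1H e1K] [e2 e2H e2K].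
have /spanning_treeP[sT iT sp] := tT.
have [A inA] : exists A : {set E}, forall e,
    (e \in A) = ((ends H e).1 \in K) || ((ends H e).2 \in K).
  by exists [set e | ((ends H e).1 \in K) || ((ends H e).2 \in K)] => e; rewrite inE.
have adjE e : e \in edges H -> adj (ends H e).1 (ends H e).2.
  by move=> eH; apply/exists_inP; exists e; rewrite // /joins -surjective_pairing eqxx.
have adjE' e : e \in edges H -> adj (ends H e).2 (ends H e).1.
  by move=> eH; apply/exists_inP; exists e; rewrite // joinsC /joins -surjective_pairing eqxx.
have Aends e : e \in edges H -> e \in A ->
    (ends H e).1 \in v |: K /\ (ends H e).2 \in v |: K.
  move=> eH; rewrite inA => /orP[eK|eK].
    by rewrite (adjK _ _ (adjE _ eH)) // setU1r.
  by rewrite (adjK _ _ (adjE' _ eH)) // setU1r.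
have link b e : b \in T -> e \in edges H -> e \notin span H (T :\ b) -> (b \in A) = (e \in A).
  move=> bT eH; have := subsetP sp _ eH; rewrite !inE eH /= => eT; apply: contraNeq => neA.
  case: (boolP (e \in A)) neA => [eA|eA].
    rewrite eqb_id => bA; have [p1 p2] := Aends e eH eA.
    (* Collapse the outside of [K]: the edges outside [A] become trivial. *)
    pose p u := if u \in v |: K then u else v.
    have -> : (ends H e).1 = p (ends H e).1 by rewrite /p p1.
    have -> : (ends H e).2 = p (ends H e).2 by rewrite /p p2.
    apply: conn_project eT => f fH fT.
    case: (boolP (f \in A)) => fA.
      have [q1 q2] := Aends f fH fA; rewrite /p q1 q2; apply: conn_ends => //.
      by rewrite !inE fT andbT; apply: contraNneq bA => <-.
    move: fA; rewrite inA negb_or => /andP[f1 f2].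
    have pv u : u \notin K -> p u = v.
      by move=> uK; rewrite /p in_setU1 (negPf uK) orbF; case: eqP.
    by rewrite !pv // conn0.
  rewrite eqbF_neg negbK => bA.
  (* Collapse [K]: the edges in [A] become trivial. *)
  pose p u := if u \in K then v else u.
  move: eA; rewrite inA negb_or => /andP[p1 p2].
  have -> : (ends H e).1 = p (ends H e).1 by rewrite /p (negPf p1).
  have -> : (ends H e).2 = p (ends H e).2 by rewrite /p (negPf p2).
  apply: conn_project eT => f fH fT.
  case: (boolP (f \in A)) => fA.
    have pv u : u \in v |: K -> p u = v by case/setU1P=> [->|]; rewrite /p ?(negPf vK) // => ->.
    by have [q1 q2] := Aends f fH fA; rewrite !pv // conn0.
  move: (fA); rewrite inA negb_or => /andP[f1 f2]; rewrite /p (negPf f1) (negPf f2).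
  apply: conn_ends => //; rewrite !inE fT andbT; apply: contraNneq fA => ->.
  by [].
apply: (@act_two _ _ _ T _ _ _ A).
- by move=> x y; rewrite linkedC.
- exact: linked_side.
- move=> x y /orP[] /and3P[bT /setDP[eH _] esp] xA.
    by rewrite -(link x y).
  by rewrite (link y x).
- by apply/set0Pn; exists e1; rewrite inE e1H inA.
- by apply/set0Pn; exists e2; rewrite inE e2H inA negb_or e2K.
Qed.

Lemma verticesP x :
  reflect (exists2 e, e \in edges H & exists y, joins e x y) (x \in vertices H).
Proof.
rewrite inE; apply: (iffP existsP) => [[y /exists_inP[e eH j]]|[e eH [y j]]].
  by exists e => //; exists y.
by exists y; apply/exists_inP; exists e.
Qed.

(** A loop, a disconnection or a cut vertex would give two parts without links
    between them, hence two active elements.  A disconnection between [x] and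
    [y] is treated as a separation at [y] with no edge reaching [y]. *)
Lemma block_of_activity : #|actH| = 1 -> 1 < #|edges H| -> two_connected_block H.
Proof.
move=> act1 cardH; have /spanning_treeP[sT iT sp] := tT.
have two : ~ 1 < #|actH| by rewrite act1.
have nonloop e : ~~ is_loop H e.
  apply/negP => /andP[eH /eqP le]; apply: two.
  have esp S : e \in span H S by rewrite inE eH le conn0.
  apply: (@act_two _ _ _ T _ _ _ [set e]).
  - by move=> x y; rewrite linkedC.
  - exact: linked_side.
  - move=> x y rxy /set1P exy; move: rxy; rewrite {}exy => /orP[] /and3P[].
      by move=> eT; case/negP: (iT e eT).
    by rewrite esp.
  - by apply/set0Pn; exists e; rewrite !inE eH eqxx.
  - rewrite -card_gt0 cardsD; apply: leq_trans (leq_sub2l _ (subset_leq_card (subsetIr _ _))).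
    by rewrite cards1 subn_gt0.
have joinK (K : {set vertex H}) e x y : joins e x y -> x \in K ->
    ((ends H e).1 \in K) || ((ends H e).2 \in K).
  by case/joins_endsP=> -[-> ->] ->; rewrite ?orbT.
have joinNK (K : {set vertex H}) e x y : joins e x y -> x \notin K -> y \notin K ->
    ((ends H e).1 \notin K) && ((ends H e).2 \notin K).
  by case/joins_endsP=> -[-> ->] -> ->.
apply/and3P; split=> //; first exact/forallP.
apply/and3P; split.
- have /card_gt0P[e eH] := ltnW cardH; have := nonloop e; rewrite /is_loop eH /= => ne.
  apply/card_gt1P; exists (ends H e).1, (ends H e).2; split=> //; apply/verticesP.
    by exists e => //; exists (ends H e).2; apply/joins_endsP; left.
  by exists e => //; exists (ends H e).1; apply/joins_endsP; right.
- apply/forall_inP => x /verticesP[e1 e1H [x' j1]].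
  apply/forall_inP => y /verticesP[e2 e2H [y' j2]].
  apply/negPn/negP => nc; apply: two.
  (* No edge leaves the component of [x]; [y] is only a place holder. *)
  apply: (@vertex_separation [set z | connect (@adj E H) x z] y).
  + by rewrite inE.
  + by move=> u w uw; rewrite !inE => c; rewrite (connect_trans c (connect1 uw)) orbT.
  + by exists e1 => //; apply: joinK j1 _; rewrite inE connect0.
  + exists e2 => //; apply: (joinNK _ _ _ _ j2); rewrite inE //.
    apply: contra nc => c; apply: connect_trans c (connect1 _).
    by apply/exists_inP; exists e2 => //; move: j2; rewrite joinsC.
- apply/forall_inP => v vV; apply/forall_inP => x /setD1P[nxv /verticesP[e1 e1H [x' j1]]].
  apply/forall_inP => y /setD1P[nyv /verticesP[e2 e2H [y' j2]]].
  apply/negPn/negP => nc; apply: two.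
  have cv : ~~ connect (adj_avoiding v) x v.
    apply/negP => /connectP[p pp]; move: pp; case/lastP: p => [_ /= evx|p z].
      by rewrite evx eqxx in nxv.
    rewrite rcons_path last_rcons => /andP[_ /and3P[_ nz _]] ez.
    by rewrite ez eqxx in nz.
  apply: (@vertex_separation [set z | connect (adj_avoiding v) x z] v).
  + by rewrite inE.
  + move=> u w uw; rewrite !inE => c; case: (eqVneq w v) => //= nwv.
    have nuv : u != v by move: c; apply: contraTneq => ->.
    by apply: connect_trans c (connect1 _); rewrite /adj_avoiding nuv nwv uw.
  + by exists e1 => //; apply: joinK j1 _; rewrite inE connect0.
  + exists e2 => //; apply: (joinNK _ _ _ _ j2); rewrite inE //.
    case: (eqVneq y' v) => [->//|ny'v].
    apply: contra nc => c; apply: connect_trans c (connect1 _).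
    by rewrite /adj_avoiding ny'v nyv; apply/exists_inP; exists e2 => //; move: j2; rewrite joinsC.
Qed.

Lemma single_isthmus_of_activity :
  #|int_act H T| = 1 -> #|edges H| <= 1 -> single_isthmus H.
Proof.
move=> /eqP/cards1P[e def_e] cardH; have /spanning_treeP[sT iT _] := tT.
have eT : e \in T.
  have : e \in int_act H T by rewrite def_e set11.
  by rewrite int_actE => /setIP[].
have eH := subsetP sT _ eT.
have edgesE : edges H = [set e].
  by apply/esym/eqP; rewrite eqEcard sub1set eH cards1.
apply/existsP; exists e; rewrite edgesE eqxx /is_isthmus edgesE set11 /=.
have := iT e eT; rewrite inE eH /=; apply: contra.
by apply: conn_span; rewrite edgesE setICr sub0set.
Qed.

Lemma single_loop_of_activity :
  #|ext_act H T| = 1 -> #|edges H| <= 1 -> single_loop H.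
Proof.
move=> /eqP/cards1P[e def_e] cardH; have /spanning_treeP[sT _ /subsetP sp] := tT.
have /setDP[ea eT] : e \in actH :\: T by rewrite -ext_actE def_e set11.
have eH := subsetP (act_sub _ _) _ ea.
have edgesE : edges H = [set e].
  by apply/esym/eqP; rewrite eqEcard sub1set eH cards1.
apply/existsP; exists e; rewrite edgesE eqxx /is_loop eH /=.
have := sp e eH; rewrite inE eH /= => c; apply/eqP.
apply: (@conn_min _ _ T (@eq _)) c => //; first by move=> x y z ->.
move=> f; rewrite edgesE => /set1P-> eT'; by rewrite eT' in eT.
Qed.

End TreeActivity.

(** ** Trees of the minors of a filtration *)

Section Main.
Variables (d : Order.disp_t) (E : finOrderType d) (G : graph E).
Implicit Types (T : {set E}) (Phi : filtration E).

Section Minor.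
Variables (T F' F : {set E}).
Hypotheses (tT : spanning_tree G T) (sF'F : F' \subset F) (sFG : F \subset edges G).
Hypotheses (spF' : spans_in G T F') (spF : spans_in G T F).

Lemma act_minor : act (linked (minor G F' F) (T :&: (F :\: F'))) (F :\: F')
  = act (linked G T) (F :\: F').
Proof.
apply/setP => x; rewrite [LHS]in_set [RHS]in_set; case: (boolP (x \in F :\: F')) => //= xD.
by apply: eq_forallb_in => y yD; rewrite linked_minor.
Qed.

Lemma int_act_minor : int_act (minor G F' F) (T :&: (F :\: F'))
  = act (linked G T) (F :\: F') :&: T.
Proof.
rewrite int_actE ?edges_minor ?act_minor //; last exact: tree_of_minor.
by rewrite setIA setIAC (setIidPl (act_sub _ _)).
Qed.

Lemma ext_act_minor : ext_act (minor G F' F) (T :&: (F :\: F'))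
  = act (linked G T) (F :\: F') :\: T.
Proof.
rewrite ext_actE ?edges_minor ?act_minor //; last exact: tree_of_minor.
by rewrite setDIr (_ : _ :\: (F :\: F') = set0) ?setU0 //; apply/eqP; rewrite setD_eq0 act_sub.
Qed.

End Minor.

Definition block Phi (i : 'I_(eps_of Phi) + 'I_(iota_of Phi)) : {set E} :=
  match i with inl k => dn_diff Phi k | inr k => up_diff Phi k end.

Lemma block_disjoint Phi i j : is_filtration G Phi -> i != j ->
  [disjoint @block Phi i & @block Phi j].
Proof.
move=> fPhi; have dis (A B C D : {set E}) : A \subset D -> [disjoint A :\: B & C :\: D].
  move=> sAD; apply/pred0P => z /=; rewrite !inE.
  by case: (boolP (z \in A)) => [/(subsetP sAD)->|]; rewrite ?andbF.
have updn (k : 'I_(iota_of Phi)) (l : 'I_(eps_of Phi)) : [disjoint dn_diff Phi l & up_diff Phi k].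
  by apply/dis/(Fdn_Fup fPhi); apply: ltnW.
have ordered n (D : nat -> {set E}) (k l : 'I_n) : k != l ->
    (forall a b, a < b -> b < n -> [disjoint D a & D b]) -> [disjoint D k & D l].
  move=> nkl disD; have : k != l :> nat by apply: contraNneq nkl => /val_inj->.
  rewrite neq_ltn => /orP[lt|lt]; first exact: disD.
  by rewrite disjoint_sym; apply: disD.
case: i j => [k|k] [l|l] /= nkl.
- apply: ordered => // a b ltab ltb; rewrite disjoint_sym.
  by apply/dis/(Fdn_mono fPhi ltab)/ltnW.
- exact: updn.
- by rewrite disjoint_sym updn.
- by apply: ordered => // a b ltab ltb; apply/dis/(Fup_mono fPhi ltab)/ltnW.
Qed.

(** Trees of the minors are glued in the order of inclusion, through the sets
    [Fdn] from the empty set to the core, then through the sets [Fup]. *)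
Lemma glued_tree Phi (T' : 'I_(eps_of Phi) -> {set E})
    (T_ : 'I_(iota_of Phi) -> {set E}) T :
  is_filtration G Phi -> tree_parts G T' T_ -> T = \bigcup_i all_parts T' T_ i ->
  [/\ spanning_tree G T, forall i, all_parts T' T_ i = T :&: block i,
      forall k, k <= iota_of Phi -> spans_in G T (Fup Phi k) &
      forall k, k <= eps_of Phi -> spans_in G T (Fdn Phi k)].
Proof.
move=> fPhi [dn up] defT.
have [[dn0 upX] sdn sup _ _] := fPhi.
have part_sub i : all_parts T' T_ i \subset block i.
  case: i => k /=.
    have [/spanning_treeP[sT _ _] _ _] := dn k.
    by rewrite edges_minor // in sT; apply: Fdn_edges => //; apply: ltnW.
  have [/spanning_treeP[sT _ _] _ _] := up k.
  by rewrite edges_minor // in sT; apply: Fup_edges.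
have partE i : all_parts T' T_ i = T :&: block i.
  apply/eqP; rewrite eqEsubset subsetI part_sub andbT {1}defT (bigcup_sup i) //=.
  apply/subsetP => x /setIP[]; rewrite defT => /bigcupP[j _ xj] xi.
  case: (eqVneq j i) => [<-//|/(block_disjoint fPhi)/pred0P/(_ x)].
  by rewrite /= xi (subsetP (part_sub j)).
have tdn j k : k + j = eps_of Phi -> tree_in G T (Fdn Phi k).
  elim: j k => [|j IHj] k; first rewrite addn0 => ->.
    rewrite dn0; split; first exact: sub0set.
    by move=> f; rewrite setI0 in_set0.
  rewrite addnS -addSn => kj; have ltk : k < eps_of Phi by rewrite -kj leq_addr.
  apply: tree_in_glue (Fdn_mono fPhi (leqnSn k) ltk) (Fdn_edges fPhi (ltnW ltk)) (IHj _ kj) _.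
  by have := partE (inl (Ordinal ltk)) => /= <-; have [] := dn (Ordinal ltk).
have tup k : k <= iota_of Phi -> tree_in G T (Fup Phi k).
  elim: k => [_|k IHk ltk]; first exact: (tdn (eps_of Phi) 0).
  apply: tree_in_glue (Fup_mono fPhi (leqnSn k) ltk) (Fup_edges fPhi ltk) (IHk (ltnW ltk)) _.
  by have := partE (inr (Ordinal ltk)) => /= <-; have [] := up (Ordinal ltk).
have sTX : T \subset edges G.
  rewrite defT; apply/bigcupsP => i _; apply: subset_trans (part_sub i) _.
  case: i => k /=; apply: subset_trans (subsetDl _ _) _.
    by apply: Fdn_edges => //; apply: ltnW.
  exact: Fup_edges.
split=> //.
- apply/spanning_treeP; have [spX iX] := tup _ (leqnn _).
  by rewrite upX /spans_in (setIidPl sTX) in spX iX.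
- by move=> k /tup[].
- by move=> k lek; have [] := tdn (eps_of Phi - k) k (subnKC lek).
Qed.

Lemma glued_adapted Phi (T' : 'I_(eps_of Phi) -> {set E})
    (T_ : 'I_(iota_of Phi) -> {set E}) T :
  is_filtration G Phi -> tree_parts G T' T_ -> T = \bigcup_i all_parts T' T_ i ->
  adapted G T (linked G T) Phi.
Proof.
move=> fPhi parts defT; have [tT partE spup spdn] := glued_tree fPhi parts defT.
have [dn up] := parts; split=> // [k lek|k lek|k ltk|k ltk].
- by apply/(spans_inP tT); [apply: Fup_edges | apply: spup].
- by apply/(spans_inP tT); [apply: Fdn_edges | apply: spdn].
- have [_ <- <-] := up (Ordinal ltk); have /= -> := partE (inr (Ordinal ltk)).
  have [sub sX] := (Fup_mono fPhi (leqnSn k) ltk, Fup_edges fPhi ltk).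
  have [s1 s2] := (spup _ ltk, spup _ (ltnW ltk)).
  by split; [rewrite int_act_minor | rewrite ext_act_minor].
- have [_ <- <-] := dn (Ordinal ltk); have /= -> := partE (inl (Ordinal ltk)).
  have [sub sX] := (Fdn_mono fPhi (leqnSn k) ltk, Fdn_edges fPhi (ltnW ltk)).
  have [s1 s2] := (spdn _ ltk, spdn _ (ltnW ltk)).
  by split; [rewrite int_act_minor | rewrite ext_act_minor].
Qed.

Section Tree.
Variables (T : {set E}).
Hypothesis tT : spanning_tree G T.

Lemma adapted_parts Phi : adapted G T (linked G T) Phi ->
  tree_parts G (fun k : 'I_(eps_of Phi) => T :&: dn_diff Phi k)
               (fun k : 'I_(iota_of Phi) => T :&: up_diff Phi k).
Proof.
case=> fPhi cup cdn up dn.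
have spup k : k <= iota_of Phi -> spans_in G T (Fup Phi k).
  by move=> lek; apply/(spans_inP tT); [apply: Fup_edges | apply: cup].
have spdn k : k <= eps_of Phi -> spans_in G T (Fdn Phi k).
  by move=> lek; apply/(spans_inP tT); [apply: Fdn_edges | apply: cdn].
split=> k; have ltk := ltn_ord k.
  have [sub sX] := (Fdn_mono fPhi (leqnSn k) ltk, Fdn_edges fPhi (ltnW ltk)).
  have [s1 s2] := (spdn _ ltk, spdn _ (ltnW ltk)); have [<- <-] := dn k ltk.
  by split; [apply: tree_of_minor | rewrite int_act_minor | rewrite ext_act_minor].
have [sub sX] := (Fup_mono fPhi (leqnSn k) ltk, Fup_edges fPhi ltk).
have [s1 s2] := (spup _ ltk, spup _ (ltnW ltk)); have [<- <-] := up k ltk.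
by split; [apply: tree_of_minor | rewrite int_act_minor | rewrite ext_act_minor].
Qed.

Lemma adapted_cover Phi : is_filtration G Phi ->
  T = \bigcup_i all_parts (fun k : 'I_(eps_of Phi) => T :&: dn_diff Phi k)
                          (fun k : 'I_(iota_of Phi) => T :&: up_diff Phi k) i.
Proof.
move=> fPhi; have /spanning_treeP[/subsetP sT _ _] := tT.
apply/setP => x; apply/idP/bigcupP => [xT|[[k|k] _ /setIP[]//]].
case: (filtration_cover fPhi (sT x xT)) => -[k ltk xk].
  by exists (inr (Ordinal ltk)) => //=; rewrite inE xT.
by exists (inl (Ordinal ltk)) => //=; rewrite inE xT.
Qed.

End Tree.

Lemma block_or_isthmus (H : graph E) T : spanning_tree H T ->
  #|int_act H T| = 1 -> #|ext_act H T| = 0 ->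
  two_connected_block H || single_isthmus H.
Proof.
move=> tT i1 e0; case: (leqP #|edges H| 1) => cH.
  by rewrite (single_isthmus_of_activity tT i1 cH) orbT.
rewrite (block_of_activity tT) //.
by rewrite -(cardsID T) -int_actE // -ext_actE // i1 e0.
Qed.

Lemma block_or_loop (H : graph E) T : spanning_tree H T ->
  #|int_act H T| = 0 -> #|ext_act H T| = 1 ->
  two_connected_block H || single_loop H.
Proof.
move=> tT i0 e1; case: (leqP #|edges H| 1) => cH.
  by rewrite (single_loop_of_activity tT e1 cH) orbT.
rewrite (block_of_activity tT) //.
by rewrite -(cardsID T) -int_actE // -ext_actE // i0 e1.
Qed.

Lemma connected_of_parts Phi (T' : 'I_(eps_of Phi) -> {set E})
    (T_ : 'I_(iota_of Phi) -> {set E}) :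
  is_filtration G Phi -> tree_parts G T' T_ -> connected_filtration G Phi.
Proof.
move=> fPhi [dn up]; split=> // k ltk.
  by have [tk ik ek] := up (Ordinal ltk); apply: block_or_isthmus tk ik ek.
by have [tk ik ek] := dn (Ordinal ltk); apply: block_or_loop tk ik ek.
Qed.

Lemma disjoint_union_eq (I : finType) (A A' : I -> {set E}) B :
  A =1 A' -> disjoint_union A B -> disjoint_union A' B.
Proof.
move=> eqA [-> disA]; split; first exact: eq_bigr.
by move=> i j; rewrite -!eqA; apply: disA.
Qed.

End Main.

(** * The decomposition *)

Theorem theorem5p1 (d : Order.disp_t) (E : finOrderType d) (G : graph E)
    (Gconn : connected G) :
  [/\ forall T : {set E}, spanning_tree G T <->
        exists2 Phi : filtration E,
          connected_filtration G Phi & filtration_trees G Phi T,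
      forall (Phi Psi : filtration E) (T : {set E}),
        connected_filtration G Phi -> connected_filtration G Psi ->
        filtration_trees G Phi T -> filtration_trees G Psi T -> Phi = Psi &
      forall (Phi : filtration E)
             (T' : 'I_(eps_of Phi) -> {set E})
             (T_ : 'I_(iota_of Phi) -> {set E})
             (T : {set E}),
        connected_filtration G Phi -> tree_parts G T' T_ ->
        T = \bigcup_i all_parts T' T_ i ->
        [/\ disjoint_union (all_parts T' T_) T,
            disjoint_union
              (fun k : 'I_(iota_of Phi) => least (up_diff Phi k))
              (int_act G T),
            disjoint_union
              (fun k : 'I_(iota_of Phi) => int_act (up_minor G Phi k) (T_ k))
              (int_act G T),
            disjoint_union
              (fun k : 'I_(eps_of Phi) => least (dn_diff Phi k))
              (ext_act G T) &
            disjoint_union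
              (fun k : 'I_(eps_of Phi) => ext_act (dn_minor G Phi k) (T' k))
              (ext_act G T)]].
Proof.
split=> [T|Phi Psi T [fPhi _ _] [fPsi _ _] [T1 [T2 [parts defT]]] [U1 [U2 [qarts defU]]]|].
- split=> [tT|[Phi [fPhi _ _] [T' [T_ [parts defT]]]]]; last first.
    by have [] := glued_tree fPhi parts defT.
  have aF := adapted_filtration_of (@linkedC _ G T) (linked_edges tT) (@linked_side _ G T).
  have [fF _ _ _ _] := aF; have parts := adapted_parts tT aF.
  exists (filtration_of G T (linked G T)); first exact: connected_of_parts fF parts.
  by eexists; eexists; split; [exact: parts | exact: (adapted_cover tT fF)].
- have [tT _ _ _] := glued_tree fPhi parts defT.
  have uniq := @adapted_unique _ _ G _ _ (@linkedC _ G T) (@linked_side _ G T).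
  rewrite (uniq Phi (glued_adapted fPhi parts defT)).
  by rewrite (uniq Psi (glued_adapted fPsi qarts defU)).
move=> Phi T' T_ T [fPhi _ _] parts defT.
have [tT partE spup spdn] := glued_tree fPhi parts defT.
have aPhi := glued_adapted fPhi parts defT.
have [rC rT] := (@linkedC _ G T, @linked_side _ G T).
have leastS (A : {set E}) : least A \subset A by apply/subsetP => x /leastP[].
have ints : disjoint_union (fun k : 'I_(iota_of Phi) => least (up_diff Phi k)) (int_act G T).
  split=> [|k l nkl].
    rewrite int_actE //; apply/setP => x; apply/idP/bigcupP.
      by move/(adapted_int rC rT aPhi) => [k ltk xk]; exists (Ordinal ltk).
    by move=> [k _ xk]; apply/(adapted_int rC rT aPhi); exists k.
  apply: disjointWl (leastS _) _; apply: disjointWr (leastS _) _.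
  exact: (block_disjoint (i := inr k) (j := inr l) fPhi nkl).
have exts : disjoint_union (fun k : 'I_(eps_of Phi) => least (dn_diff Phi k)) (ext_act G T).
  split=> [|k l nkl].
    rewrite ext_actE //; apply/setP => x; apply/idP/bigcupP.
      by move/(adapted_ext rT aPhi) => [k ltk xk]; exists (Ordinal ltk).
    by move=> [k _ xk]; apply/(adapted_ext rT aPhi); exists k.
  apply: disjointWl (leastS _) _; apply: disjointWr (leastS _) _.
  exact: (block_disjoint (i := inl k) (j := inl l) fPhi nkl).
split=> //.
- split=> // i j nij; rewrite !partE; apply: disjointWl (subsetIr _ _) _.
  apply: disjointWr (subsetIr _ _) _; exact: block_disjoint fPhi nij.
- apply: disjoint_union_eq ints => k; have /= -> := partE (inr k).
  have ltk := ltn_ord k; have [s1 s2] := (spup _ ltk, spup _ (ltnW ltk)).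
  have [sub sX] := (Fup_mono fPhi (leqnSn k) ltk, Fup_edges fPhi ltk).
  rewrite int_act_minor //.
  by have [-> sT] := up_act rT aPhi ltk; rewrite (setIidPl sT).
- apply: disjoint_union_eq exts => k; have /= -> := partE (inl k).
  have ltk := ltn_ord k; have [s1 s2] := (spdn _ ltk, spdn _ (ltnW ltk)).
  have [sub sX] := (Fdn_mono fPhi (leqnSn k) ltk, Fdn_edges fPhi (ltnW ltk)).
  rewrite ext_act_minor //.
  by have [-> sT] := dn_act rT aPhi ltk; rewrite (setDidPl sT).
Qed.
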